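(* Let $R$ be a commutative Noetherian local ring, $\mathfrak{a}$ an ideal of $R$, and $M$ an $R$-module (not necessarily finitely generated). Let $n$ be a non-negative integer such that $H^i_{\mathfrak{a}}(M)=0$ for all $i\neq n$. Then: (i) $\operatorname{fd}_R H^n_{\mathfrak{a}}(M)\le \operatorname{fd}_R M+n$; and (ii) the equality $\operatorname{fd}_R H^n_{\mathfrak{a}}(M)=\operatorname{fd}_R M+n$ holds whenever $M$ is finitely generated.
   Context: $H^i_{\mathfrak{a}}(M)$ denotes the $i$-th local cohomology module of $M$ with respect to $\mathfrak{a}$, and $\operatorname{fd}_R$ denotes flat dimension, which may be infinite. Convention: the flat dimension of the zero module is $-\infty$.
   Formalization: In part (ii) the ideal a is assumed proper; for a = R every local cohomology module vanishes, so equality fails for any nonzero finitely generated M (e.g. M = R, n = 0: fd H^0 = −∞ but fd M + 0 = 0). *)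

(* Defs.v *)
From HB Require Import structures.
From mathcomp Require Import all_boot all_order all_algebra.
From mathcomp Require Import generic_quotient ring_quotient.
From mathcomp Require Import boolp classical_sets constructive_ereal.
From mathcomp.multinomials Require Import freeg.

Set Implicit Arguments.
Unset Strict Implicit.
Unset Printing Implicit Defensive.

Import Order.TTheory GRing.Theory Num.Theory.

Local Open Scope classical_set_scope.
Local Open Scope ring_scope.
Local Open Scope quotient_scope.

Record submodule (R : comNzRingType) (M : lmodType R) := Submodule {
  submodule_pred :> {pred M};
  submodule_closed : submod_closed submodule_pred }.

HB.instance Definition _ (R : comNzRingType) (M : lmodType R)
    (S : submodule M) :=
  GRing.isSubmodClosed.Build R M (submodule_pred S) (submodule_closed S).

Section SubmoduleType.
Variables (R : comNzRingType) (M : lmodType R) (S : submodule M).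

Record submod := SubMod { submod_val : M; submod_valP : submod_val \in S }.

HB.instance Definition _ := [isSub for submod_val].
HB.instance Definition _ := [Choice of submod by <:].
HB.instance Definition _ := [SubChoice_isSubLmodule of submod by <:].

End SubmoduleType.

Section Span.
Variables (R : comNzRingType) (M : lmodType R) (A : set M).

Definition span_pred : {pred M} :=
  fun x => `[< forall S : submodule M, A `<=` [set` S] -> x \in S >].

Lemma span_closed : submod_closed span_pred.
Proof.
split=> [|c x y].
  by apply/asboolP => S _; exact: rpred0.
move=> /asboolP hx /asboolP hy; apply/asboolP => S AS.
by rewrite rpredD ?rpredZ ?hx ?hy.
Qed.

Definition span : submodule M := Submodule span_closed.

Lemma mem_span x : A x -> x \in span.
Proof. by move=> Ax; apply/asboolP => S AS; exact: AS. Qed.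

Lemma span_min (S : submodule M) : A `<=` [set` S] -> {subset span <= S}.
Proof. by move=> AS x /asboolP; apply. Qed.

End Span.

Section QuotientModule.
Variables (R : comNzRingType) (M : lmodType R) (S : submodule M).

Definition quotmod := Quotient.quot (submodule_pred S).

HB.instance Definition _ := GRing.Zmodule.on quotmod.

Definition quot_pi (x : M) : quotmod := \pi_(Quotient.quot (submodule_pred S)) x.

Lemma quot_piP x y : quot_pi x = quot_pi y <-> x - y \in S.
Proof. by split=> [/eqP|h]; [|apply/eqP]; rewrite -Quotient.idealrBE. Qed.

Lemma quot_reprK : cancel (fun u : quotmod => repr u) quot_pi.
Proof. exact: reprK. Qed.

Lemma quot_piD x y : quot_pi (x + y) = quot_pi x + quot_pi y.
Proof. exact: (raddfD (\pi_(Quotient.quot (submodule_pred S)))). Qed.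

Definition quot_scale (c : R) (u : quotmod) : quotmod := quot_pi (c *: repr u).

Lemma quot_scaleE c x : quot_scale c (quot_pi x) = quot_pi (c *: x).
Proof. by apply/quot_piP; rewrite -scalerBr rpredZ//; apply/quot_piP/quot_reprK. Qed.

Lemma quot_scaleA a b u : quot_scale a (quot_scale b u) = quot_scale (a * b) u.
Proof. by rewrite -[u]quot_reprK !quot_scaleE scalerA. Qed.

Lemma quot_scale1 : left_id 1 quot_scale.
Proof. by move=> u; rewrite -[u]quot_reprK quot_scaleE scale1r. Qed.

Lemma quot_scaleDr : right_distributive quot_scale +%R.
Proof.
move=> c u v; rewrite -[u]quot_reprK -[v]quot_reprK.
by rewrite -quot_piD !quot_scaleE scalerDr quot_piD.
Qed.

Lemma quot_scaleDl u : {morph quot_scale^~ u : a b / a + b}.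
Proof. by move=> a b; rewrite -[u]quot_reprK !quot_scaleE scalerDl quot_piD. Qed.

HB.instance Definition _ := GRing.Zmodule_isLmodule.Build R quotmod
  quot_scaleA quot_scale1 quot_scaleDr quot_scaleDl.

Lemma quot_pi_linear : linear quot_pi.
Proof. by move=> c x y; rewrite quot_piD -quot_scaleE. Qed.

HB.instance Definition _ := GRing.isLinear.Build R M quotmod *:%R quot_pi
  quot_pi_linear.

Section Lift.
Variables (N : lmodType R) (f : {linear M -> N}).
Hypothesis fS : forall x, x \in S -> f x = 0.

Definition quot_lift (u : quotmod) : N := f (repr u).

Lemma quot_liftE x : quot_lift (quot_pi x) = f x.
Proof.
apply/eqP; rewrite -subr_eq0 /quot_lift -linearB fS//.
by apply/quot_piP/quot_reprK.
Qed.

End Lift.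
End QuotientModule.

Section FreeModuleLift.
Variables (R : comNzRingType) (K : choiceType) (M : lmodType R) (f : K -> M).

Definition free_lift : {freeg K / R} -> M := fglift f.

Lemma free_lift_linear : linear free_lift.
Proof.
have h := @lift_is_additive R K M f; rewrite -/free_lift in h.
have f0 : free_lift 0 = 0 by rewrite -(subrr 0) h subrr.
have fN z : free_lift (- z) = - free_lift z by rewrite -sub0r h f0 sub0r.
have fD x y : free_lift (x + y) = free_lift x + free_lift y.
  by rewrite -[y in LHS]opprK h fN opprK.
move=> c x y; rewrite fD; congr (_ + _).
rewrite -[x in RHS]freeg_sumE [c *: x]/(fgscale c x) /fgscale.
elim: (dom x) => [|k s IHs]; first by rewrite !big_nil f0 scaler0.
by rewrite !big_cons !fD IHs scalerDr /free_lift !liftU scalerA.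
Qed.

HB.instance Definition _ := GRing.isLinear.Build R {freeg K / R} M *:%R free_lift
  free_lift_linear.

Lemma free_liftE k : free_lift << k >> = f k.
Proof. by rewrite /free_lift liftU scale1r. Qed.

End FreeModuleLift.

(* The tensor product, as the free module on M * N modulo the bilinearity
   relations. *)
Section Tensor.
Variables (R : comNzRingType) (M N : lmodType R).

Definition tensor_rel : set {freeg (M * N) / R} :=
  [set u | exists m m' n, u = << (m + m', n) >> - << (m, n) >> - << (m', n) >>]
  `|`
  [set u | exists m n n', u = << (m, n + n') >> - << (m, n) >> - << (m, n') >>]
  `|`
  [set u | exists c m n, u = << (c *: m, n) >> - c *: << (m, n) >>]
  `|`
  [set u | exists c m n, u = << (m, c *: n) >> - c *: << (m, n) >>].

Definition tensor : lmodType R := quotmod (span tensor_rel).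

Definition tensor_pure (m : M) (n : N) : tensor := quot_pi _ << (m, n) >>.

Section Lift.
Variables (P : lmodType R) (b : M -> N -> P).

Definition tensor_lift (u : tensor) : P :=
  quot_lift (free_lift (fun p : M * N => b p.1 p.2)) u.

Hypotheses (bl : forall n, linear (b^~ n)) (br : forall m, linear (b m)).

Let ker_submod (V W : lmodType R) (f : {linear V -> W}) :
  submod_closed [pred x | f x == 0].
Proof.
split=> [|c x y]; rewrite !inE ?linear0// => /eqP fx /eqP fy.
by rewrite linearP fx fy scaler0 addr0.
Qed.

Lemma tensor_lift_rel u : u \in span tensor_rel ->
  free_lift (fun p : M * N => b p.1 p.2) u = 0.
Proof.
set f := free_lift _ => uS.
have linD (V W : lmodType R) (g : V -> W) : linear g ->
    forall x y, g (x + y) = g x + g y.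
  by move=> gl x y; have := gl 1 x y; rewrite !scale1r.
have linZ (V W : lmodType R) (g : V -> W) : linear g ->
    forall c x, g (c *: x) = c *: g x.
  move=> gl; have g0 : g 0 = 0.
    by apply: (addrI (g 0)); rewrite -linD// !addr0.
  by move=> c x; have := gl c x 0; rewrite g0 !addr0.
apply/eqP; apply: (@span_min _ _ tensor_rel (Submodule (ker_submod f))) uS => v.
by case=> [[[|]|]|] [x [y [z ->]]]; apply/eqP;
  rewrite !linearB/= ?linearZ/= /f !free_liftE/=;
  rewrite ?(linD _ _ _ (bl _)) ?(linD _ _ _ (br _))
          ?(linZ _ _ _ (bl _)) ?(linZ _ _ _ (br _));
  rewrite ?scalerN ?subrr// addrAC addrK subrr.
Qed.

Lemma tensor_liftE m n : tensor_lift (tensor_pure m n) = b m n.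
Proof. by rewrite /tensor_lift (quot_liftE tensor_lift_rel)/= free_liftE. Qed.

Lemma tensor_lift_linear : linear tensor_lift.
Proof.
move=> c u v; rewrite -[u]quot_reprK -[v]quot_reprK -linearP /tensor_lift.
by rewrite !(quot_liftE tensor_lift_rel) linearP.
Qed.

End Lift.

Lemma tensor_pure_linearl n : linear (tensor_pure^~ n).
Proof.
move=> c m m'; rewrite /tensor_pure -linearP; apply/quot_piP.
set x := _ - _; suff -> : x = (<< (c *: m + m', n) >> - << (c *: m, n) >>
    - << (m', n) >>) + (<< (c *: m, n) >> - c *: << (m, n) >>).
  apply: rpredD; apply: mem_span; last by left; right; exists c, m, n.
  by left; left; left; exists (c *: m), m', n.
by rewrite /x opprD addrACA subrK [- _ - _ in RHS]addrC.
Qed.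

Lemma tensor_pure_linearr m : linear (tensor_pure m).
Proof.
move=> c n n'; rewrite /tensor_pure -linearP; apply/quot_piP.
set x := _ - _; suff -> : x = (<< (m, c *: n + n') >> - << (m, c *: n) >>
    - << (m, n') >>) + (<< (m, c *: n) >> - c *: << (m, n) >>).
  apply: rpredD; apply: mem_span; last by right; exists c, m, n.
  by left; left; right; exists m, (c *: n), n'.
by rewrite /x opprD addrACA subrK [- _ - _ in RHS]addrC.
Qed.

End Tensor.

Section TensorMap.
Variables (R : comNzRingType) (M A B : lmodType R) (f : {linear A -> B}).

Definition tensor_map : tensor M A -> tensor M B :=
  tensor_lift (fun m x => tensor_pure m (f x)).

Let tensor_map_linearr (m : M) : linear (fun x => tensor_pure m (f x)).
Proof. by move=> c x y; rewrite linearP tensor_pure_linearr. Qed.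

Lemma tensor_mapE m x : tensor_map (tensor_pure m x) = tensor_pure m (f x).
Proof.
by rewrite /tensor_map tensor_liftE// => n; exact: tensor_pure_linearl.
Qed.

Lemma tensor_map_linear : linear tensor_map.
Proof. by apply: tensor_lift_linear => // n; exact: tensor_pure_linearl. Qed.

HB.instance Definition _ := GRing.isLinear.Build R (tensor M A) (tensor M B)
  *:%R tensor_map tensor_map_linear.

End TensorMap.

Arguments tensor_map {R} M {A B} f.

Section ModuleNotions.
Variable R : comNzRingType.
Implicit Types M N : lmodType R.

Definition zero_module M := forall x : M, x = 0.

Definition finitely_generated M :=
  exists s : seq M, forall x, x \in span [set` s].

Definition exact_at (A B C : lmodType R) (f : {linear A -> B})
    (g : {linear B -> C}) :=
  forall y, g y = 0 <-> exists x, f x = y.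

Definition flat M :=
  forall (A B C : lmodType R) (f : {linear A -> B}) (g : {linear B -> C}),
    exact_at f g -> exact_at (tensor_map M f) (tensor_map M g).

Definition injective_module M :=
  forall (A B : lmodType R) (i : {linear A -> B}) (f : {linear A -> M}),
    injective i -> exists g : {linear B -> M}, forall x, g (i x) = f x.

End ModuleNotions.

Section FlatDimension.
Variables (R : comNzRingType) (M : lmodType R).

Record flat_resolution := FlatResolution {
  fres_obj : nat -> lmodType R;
  fres_diff : forall i, {linear fres_obj i.+1 -> fres_obj i};
  fres_aug : {linear fres_obj 0%N -> M};
  fres_flat : forall i, flat (fres_obj i);
  fres_surj : forall x, exists y, fres_aug y = x;
  fres_exact0 : exact_at (fres_diff 0%N) fres_aug;
  fres_exact : forall i, exact_at (fres_diff i.+1) (fres_diff i) }.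

Definition has_flat_resolution_of_length (d : nat) :=
  exists F : flat_resolution, forall i, (d < i)%N -> zero_module (fres_obj F i).

Definition flat_dim : \bar int :=
  if `[< zero_module M >] then -oo%E else
  match pselect (exists d, `[< has_flat_resolution_of_length d >]) with
  | left e => ((ex_minn e)%:Z)%:E
  | right _ => +oo%E
  end.

End FlatDimension.

Section Cohomology.
Variable R : comNzRingType.

Record cochain_complex := CochainComplex {
  coch_obj :> nat -> lmodType R;
  coch_diff : forall i, {linear coch_obj i -> coch_obj i.+1};
  coch_diffK : forall i x, coch_diff i.+1 (coch_diff i x) = 0 }.

Variables (C : cochain_complex) (i : nat).

Definition cocycle_pred : {pred C i} := fun x => coch_diff C i x == 0.

Lemma cocycle_closed : submod_closed cocycle_pred.
Proof.
split=> [|c x y]; rewrite !unfold_in /cocycle_pred ?linear0// => /eqP hx /eqP hy.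
by rewrite linearP hx hy scaler0 addr0.
Qed.

Definition cocycles : submodule (C i) := Submodule cocycle_closed.

Definition is_coboundary : C i -> Prop :=
  match i return C i -> Prop with
  | 0%N => fun x => x = 0
  | j.+1 => fun x => exists y, coch_diff C j y = x
  end.

Definition coboundary_pred : {pred submod cocycles} :=
  fun z => `[< is_coboundary (val z) >].

Lemma coboundary_closed : submod_closed coboundary_pred.
Proof.
rewrite /coboundary_pred /is_coboundary.
have h : is_coboundary 0 /\ forall c x y, is_coboundary x -> is_coboundary y ->
    is_coboundary (c *: x + y).
  rewrite /is_coboundary; case: (i) => [|j].
    by split=> // c x y -> ->; rewrite scaler0 addr0.
  split=> [|c x y [u <-] [v <-]]; first by exists 0; rewrite linear0.
  by exists (c *: u + v); rewrite linearP.
split=> [|c x y]; first exact/asboolP/(h.1).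
by move=> /asboolP hx /asboolP hy; apply/asboolP; exact: h.2.
Qed.

Definition coboundaries : submodule (submod cocycles) :=
  Submodule coboundary_closed.

Definition cohomology : lmodType R := quotmod coboundaries.

End Cohomology.

Section Ideals.
Variable R : comNzRingType.

(* Improper ideals are allowed, unlike in the library's idealr. *)
Definition ideal := submodule (R^o : lmodType R).

Definition noetherian := forall J : ideal, exists s : seq R^o, J =i span [set` s].

Definition maximal_ideal (m : ideal) :=
  1 \notin m /\
  forall J : ideal, {subset m <= J} -> 1 \notin J -> {subset J <= m}.

Definition local_ring :=
  exists2 m : ideal, maximal_ideal m &
    forall m' : ideal, maximal_ideal m' -> m' =i m.

Definition ideal_exp (a : ideal) (n : nat) : ideal :=
  span [set r : R^o | exists s : seq R,
    [/\ size s = n, {subset s <= a} & r = \prod_(x <- s) x]].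

Lemma ideal_exp_sub (a : ideal) m n : (m <= n)%N ->
  {subset ideal_exp a n <= ideal_exp a m}.
Proof.
move=> mn; apply: span_min => _ [s [sn sa ->]] /=.
rewrite -(cat_take_drop m s) big_cat /= mulrC.
suff: (\prod_(x <- take m s) x : R^o) \in ideal_exp a m.
  by move=> /(rpredZ (\prod_(x <- drop m s) x)).
apply: mem_span.
exists (take m s); split=> //; first by rewrite size_take_min sn; apply/minn_idPl.
by move=> x /mem_take /sa.
Qed.

End Ideals.

Section Torsion.
Variables (R : comNzRingType) (a : ideal R).

Definition torsion_pred (M : lmodType R) : {pred M} :=
  fun x => `[< exists n, forall r, r \in ideal_exp a n -> (r : R) *: x = 0 >].

Lemma torsion_closed M : submod_closed (@torsion_pred M).
Proof.
split=> [|c x y].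
  by apply/asboolP; exists 0%N => r _; rewrite scaler0.
move=> /asboolP[m hx] /asboolP[n hy]; apply/asboolP; exists (maxn m n) => r rmn.
rewrite scalerDr scalerA mulrC -scalerA hx ?hy ?scaler0 ?addr0//.
  exact: ideal_exp_sub (leq_maxr m n) _ rmn.
exact: ideal_exp_sub (leq_maxl m n) _ rmn.
Qed.

Definition torsion_submod (M : lmodType R) : submodule M :=
  Submodule (torsion_closed M).

Definition torsion (M : lmodType R) : lmodType R := submod (torsion_submod M).

Section Map.
Variables (M N : lmodType R) (f : {linear M -> N}).

Lemma torsion_map_subproof (x : torsion M) : f (val x) \in torsion_submod N.
Proof.
have /asboolP[n hx] := valP x.
by apply/asboolP; exists n => r rn; rewrite -linearZ hx// linear0.
Qed.

Definition torsion_map (x : torsion M) : torsion N :=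
  SubMod (torsion_map_subproof x).

Lemma torsion_map_linear : linear torsion_map.
Proof. by move=> c x y; apply: val_inj; rewrite !linearP/= linearP. Qed.

HB.instance Definition _ := GRing.isLinear.Build R (torsion M) (torsion N)
  *:%R torsion_map torsion_map_linear.

End Map.

Lemma torsion_complexK (C : cochain_complex R) i (x : torsion (C i)) :
  torsion_map (coch_diff C i.+1) (torsion_map (coch_diff C i) x) = 0.
Proof. by apply: val_inj; rewrite /= coch_diffK. Qed.

Definition torsion_complex (C : cochain_complex R) : cochain_complex R :=
  CochainComplex (@torsion_complexK C).

End Torsion.

Record injective_resolution (R : comNzRingType) (M : lmodType R) :=
  InjectiveResolution {
    ires_complex :> cochain_complex R;
    ires_aug : {linear M -> ires_complex 0%N};
    ires_injective : forall i, injective_module (ires_complex i);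
    ires_aug_inj : injective ires_aug;
    ires_exact0 : exact_at ires_aug (coch_diff ires_complex 0%N);
    ires_exact : forall i,
      exact_at (coch_diff ires_complex i) (coch_diff ires_complex i.+1) }.

(* The i-th right derived functor of the a-torsion functor at M, computed on
   the injective resolution I of M; up to isomorphism it does not depend on I. *)
Definition local_cohomology (R : comNzRingType) (a : ideal R) (M : lmodType R)
    (I : injective_resolution M) (i : nat) : lmodType R :=
  cohomology (torsion_complex a I) i.

(* Main.v *)
(* Let s generate a. The Cech complex C of M on s is an iterated cone of localization
   maps, and H^i(C) = H^i_a(M): both sides satisfy the same dimension-shifting
   recursion along 0 -> M -> I^0 -> M_1 -> 0, because C is acyclic on injectives (R is
   Noetherian). Since each C^i is a finite product of iterated localizations of M, and
   localization is flat, Tor_j(-, C^i) vanishes for j > fd M. As C is exact except in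
   degree n, splitting it into the short exact sequences of cycles and boundaries gives
   Tor_j(-, H^n) = 0 for j > fd M + n, which is (i).

   For (ii), let k be the residue field. Elements of a kill k and C^i, for i > 0, is
   built from localizations at elements of a, so Tor(k, C^i) = 0 for i > 0. The same
   sequences then show that Tor_{j+n}(k, H^n) = 0 implies Tor_j(k, M) = 0, and over a
   Noetherian local ring Tor_{d+1}(k, M) = 0 forces fd M <= d when M is finitely
   generated, by Nakayama's lemma and minimal generators.

   Only vanishing of Tor is used. It is stated by resolving the first argument by free
   modules on underlying sets, so that all exact sequence arguments reduce to chases in
   the bicomplex of two short exact sequences. *)

Require Import Defs.
From HB Require Import structures.
From mathcomp Require Import all_boot all_order all_algebra.
From mathcomp Require Import boolp classical_sets constructive_ereal.
From mathcomp.multinomials Require Import freeg.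
From mathcomp Require Import ring.

Import Order.TTheory GRing.Theory Num.Theory.

Set Implicit Arguments.
Unset Strict Implicit.
Unset Printing Implicit Defensive.

Local Open Scope classical_set_scope.
Local Open Scope ring_scope.

(** * Linear maps and tensor products *)

(** The torsion complex of an injective resolution is in general unbounded, with terms whose Tor is
    not under control; the Cech complex is bounded with controlled terms, and this is why the two
    must be compared. The delicate point is that an iterated cone over an injective [E] stays exact
    in positive degrees: the elements of [E] killed by powers of the elements already used must map
    onto their localization at the next one. They do because this torsion submodule again satisfies
    Baer's criterion, and here colon ideals have to stabilize. Cohomology is a quotient of a subtype
    of a subtype, so the dimension shift is carried by linear relations between representatives,
    which compose easily; only the final relation is read as a map. The constant [n] counts steps:
    Tor of the boundaries is reached from degree 0 upwards, each step raising the Tor degree by one,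
    while Tor of the cocycles is reached from the bounded end without loss. *)

Section LinearMaps.
Variable R : comNzRingType.
Implicit Types A B C Z : lmodType R.

Definition mklin A B (f : A -> B) (fl : linear f) : {linear A -> B} :=
  HB.pack f (GRing.isLinear.Build R A B *:%R f fl).

Lemma id_linear A : linear (fun x : A => x).
Proof. by []. Qed.

Lemma null_linear A B : linear (fun _ : A => 0 : B).
Proof. by move=> c x y; rewrite scaler0 addr0. Qed.
Definition null_lin A B := mklin (@null_linear A B).

Lemma scale_linear A (c : R) : linear (fun x : A => c *: x).
Proof. by move=> d x y; rewrite scalerDr !scalerA mulrC. Qed.

Lemma comp_linear A B C (f : {linear A -> B}) (g : {linear B -> C}) :
  linear (fun x => g (f x)).
Proof. by move=> c x y; rewrite !linearP. Qed.
Definition comp_lin A B C (f : {linear A -> B}) (g : {linear B -> C}) :=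
  mklin (comp_linear f g).
Lemma comp_linE A B C (f : {linear A -> B}) (g : {linear B -> C}) x :
  comp_lin f g x = g (f x).
Proof. by []. Qed.

Lemma fst_linear A B : linear (fun p : A * B => p.1).
Proof. by []. Qed.
Definition fst_lin A B : {linear (A * B)%type -> A} := mklin (@fst_linear A B).

Lemma snd_linear A B : linear (fun p : A * B => p.2).
Proof. by []. Qed.
Definition snd_lin A B : {linear (A * B)%type -> B} := mklin (@snd_linear A B).

Lemma pair_linear A B C (f : {linear A -> B}) (g : {linear A -> C}) :
  linear (fun x => (f x, g x)).
Proof. by move=> c x y; rewrite !linearP. Qed.
Definition pair_lin A B C (f : {linear A -> B}) (g : {linear A -> C}) :
  {linear A -> (B * C)%type} := mklin (pair_linear f g).

Lemma add_linear A B (f g : {linear A -> B}) : linear (fun x => f x + g x).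
Proof. by move=> c x y; rewrite !linearP scalerDr addrACA. Qed.
Definition add_lin A B (f g : {linear A -> B}) := mklin (add_linear f g).

Lemma opp_linear A B (f : {linear A -> B}) : linear (fun x => - f x).
Proof. by move=> c x y; rewrite linearP opprD scalerN. Qed.
Definition opp_lin A B (f : {linear A -> B}) := mklin (opp_linear f).

Definition idl A : {linear A -> A} := mklin (@id_linear A).

Lemma val_linear A (S : submodule A) : linear (@submod_val R A S).
Proof. by []. Qed.
Definition val_lin A (S : submodule A) : {linear submod S -> A} :=
  mklin (@val_linear A S).

Lemma corestrict_linear A B (S : submodule B) (f : {linear A -> B})
  (fS : forall x, f x \in S) : linear (fun x => SubMod (fS x)).
Proof. by move=> c x y; apply: val_inj; rewrite /= linearP. Qed.
Definition corestrict_lin A B (S : submodule B) (f : {linear A -> B})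
  (fS : forall x, f x \in S) : {linear A -> submod S} :=
  mklin (corestrict_linear fS).

Lemma ker_closed A B (f : {linear A -> B}) : submod_closed [pred x | f x == 0].
Proof.
split=> [|c x y]; rewrite !inE ?linear0// => /eqP fx /eqP fy.
by rewrite linearP fx fy scaler0 addr0.
Qed.
Definition ker A B (f : {linear A -> B}) := Submodule (ker_closed f).

Lemma mem_ker A B (f : {linear A -> B}) x : (x \in ker f) = (f x == 0).
Proof. by []. Qed.

Lemma im_closed A B (f : {linear A -> B}) :
  submod_closed (fun y : B => `[< exists x, f x = y >]).
Proof.
split=> [|c x y]; first by apply/asboolP; exists 0; rewrite linear0.
move=> /asboolP[u <-] /asboolP[v <-]; apply/asboolP; exists (c *: u + v).
by rewrite linearP.
Qed.
Definition im A B (f : {linear A -> B}) := Submodule (im_closed f).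

Lemma imP A B (f : {linear A -> B}) y : y \in im f <-> exists x, f x = y.
Proof. by split=> [/asboolP|h] //; apply/asboolP. Qed.

Lemma lin_inj A B (f : {linear A -> B}) :
  (forall x, f x = 0 -> x = 0) -> injective f.
Proof.
by move=> h x y e; apply/eqP; rewrite -subr_eq0; apply/eqP/h; rewrite linearB e subrr.
Qed.

Lemma inj0 A B (f : {linear A -> B}) x : injective f -> f x = 0 -> x = 0.
Proof. by move=> fi fx; apply: fi; rewrite fx linear0. Qed.

Definition ses A B C (f : {linear A -> B}) (g : {linear B -> C}) :=
  [/\ injective f, exact_at f g & forall z, exists y, g y = z].

(** Preimages under an injective linear map are unique, so the chosen ones depend linearly on
    [z]. *)
Lemma factor_inj A B Z (i : {linear A -> B}) (h : {linear Z -> B}) :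
  injective i -> (forall z, exists a, i a = h z) ->
  exists g : {linear Z -> A}, forall z, i (g z) = h z.
Proof.
move=> ii /choice[g gE].
have gl : linear g by move=> c x y; apply: ii; rewrite gE !linearP !gE.
by exists (mklin gl).
Qed.

Lemma ses_ker A B (f : {linear A -> B}) : (forall z, exists y, f y = z) ->
  ses (val_lin (ker f)) f.
Proof.
move=> fs; split=> //; first exact: val_inj.
move=> y; split=> [fy|[x <-]]; last by apply/eqP; case: x.
have yk : y \in ker f by rewrite mem_ker fy.
by exists (SubMod yk).
Qed.

Lemma quot_pi_surj A (S : submodule A) (z : quotmod S) : exists y, quot_pi S y = z.
Proof. by exists (repr z); exact: quot_reprK. Qed.

Lemma quot_pi0 A (S : submodule A) x : quot_pi S x = 0 <-> x \in S.
Proof. by rewrite -(linear0 (quot_pi S)) quot_piP subr0. Qed.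

Lemma ses_coker A B (f : {linear A -> B}) : injective f ->
  ses f (quot_pi (im f) : {linear B -> quotmod (im f)}).
Proof.
move=> fi; split=> // [y|z]; last exact: quot_pi_surj.
by rewrite quot_pi0 imP.
Qed.

End LinearMaps.

Section TensorBasics.
Variable R : comNzRingType.
Implicit Types A B C M N P : lmodType R.

Lemma tensor_ind M N (P : tensor M N -> Prop) :
  (forall c u v, P u -> P v -> P (c *: u + v)) ->
  (forall m n, P (tensor_pure m n)) -> forall u, P u.
Proof.
move=> PD Pp u; rewrite -[u]quot_reprK -[repr u]freeg_sumE.
(* The closure hypothesis with [c = -1] yields zero, so no separate base case is asked for. *)
have P0 : P 0 by have := PD (-1) _ _ (Pp 0 0) (Pp 0 0); rewrite scaleN1r addNr.
elim: (dom _) => [|[m n] s IH]; first by rewrite big_nil linear0; exact: P0.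
rewrite big_cons linearD.
set c := coeff _ _.
have -> : << c *g (m, n) >> = c *: << (m, n) >> :> {freeg (M * N) / R}.
  by apply/eqP/freeg_eqP => z; rewrite coeffZ !coeffU mul1r.
by rewrite linearZ; exact: PD (Pp m n) IH.
Qed.

Lemma eq_tensor M N P (f g : {linear tensor M N -> P}) :
  (forall m n, f (tensor_pure m n) = g (tensor_pure m n)) -> forall u, f u = g u.
Proof. by move=> h; apply: tensor_ind => // c u v; rewrite !linearP => -> ->. Qed.

Definition tlift M N P (b : M -> N -> P) (bl : forall n, linear (b^~ n))
  (br : forall m, linear (b m)) : {linear tensor M N -> P} :=
  mklin (tensor_lift_linear bl br).

Lemma tliftE M N P (b : M -> N -> P) (bl : forall n, linear (b^~ n))
  (br : forall m, linear (b m)) m n : tlift bl br (tensor_pure m n) = b m n.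
Proof. exact: tensor_liftE. Qed.

Definition purel M N (n : N) : {linear M -> tensor M N} :=
  mklin (@tensor_pure_linearl R M N n).
Definition purer M N (m : M) : {linear N -> tensor M N} :=
  mklin (@tensor_pure_linearr R M N m).

Lemma purelE M N (m : M) (n : N) : purel M n m = tensor_pure m n.
Proof. by []. Qed.

Lemma tensor_pureZ M N c (m : M) (n : N) :
  tensor_pure (c *: m) n = tensor_pure m (c *: n).
Proof. exact: etrans (linearZZ (purel M n) c m) (esym (linearZZ (purer N m) c n)). Qed.

Lemma tensor_mapl_linearl A B N (f : {linear A -> B}) (n : N) :
  linear (fun a => tensor_pure (f a) n).
Proof. by move=> c x y; rewrite linearP tensor_pure_linearl. Qed.

Definition tensor_mapl A B (f : {linear A -> B}) N : tensor A N -> tensor B N :=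
  tlift (tensor_mapl_linearl f) (fun a => @tensor_pure_linearr R B N (f a)).

HB.instance Definition _ A B (f : {linear A -> B}) N :=
  GRing.isLinear.Build R (tensor A N) (tensor B N) *:%R (@tensor_mapl A B f N)
    (linearP (tlift (tensor_mapl_linearl f)
      (fun a => @tensor_pure_linearr R B N (f a)))).

Lemma tensor_maplE A B (f : {linear A -> B}) N a (n : N) :
  tensor_mapl f (tensor_pure a n) = tensor_pure (f a) n.
Proof.
exact: (tliftE (tensor_mapl_linearl f) (fun a => @tensor_pure_linearr R B N (f a))).
Qed.

Lemma tensor_map_comm A B (f : {linear A -> B}) N N' (g : {linear N -> N'})
    (u : tensor A N) :
  tensor_map B g (tensor_mapl f u) = tensor_mapl f (tensor_map A g u).
Proof.
apply: (eq_tensor (f := comp_lin (@tensor_mapl _ _ f N) (tensor_map B g))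
  (g := comp_lin (tensor_map A g) (@tensor_mapl _ _ f N'))) => m n.
by rewrite /= tensor_maplE !tensor_mapE tensor_maplE.
Qed.

Lemma tensor_map_comp M A B C (f : {linear A -> B}) (g : {linear B -> C})
    (h : {linear A -> C}) : (forall x, g (f x) = h x) ->
  forall u, tensor_map M g (tensor_map M f u) = tensor_map M h u.
Proof.
move=> E; apply: (eq_tensor (f := comp_lin (tensor_map M f) (tensor_map M g))).
by move=> m n; rewrite /= !tensor_mapE E.
Qed.

Lemma tensor_map0 M A B (f : {linear A -> B}) : (forall x, f x = 0) ->
  forall u, tensor_map M f u = 0.
Proof.
move=> E; apply: (eq_tensor (g := null_lin (tensor M A) (tensor M B))).
by move=> m n /=; rewrite tensor_mapE E; exact: (linear0 (purer B m)).
Qed.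

Lemma tensor_map_id M A (f : {linear A -> A}) : (forall x, f x = x) ->
  forall u, tensor_map M f u = u.
Proof.
by move=> E; apply: (eq_tensor (g := idl _)) => m n /=; rewrite tensor_mapE E.
Qed.

Definition tswap M N : tensor M N -> tensor N M :=
  tlift (b := fun m n => tensor_pure n m)
    (fun n => @tensor_pure_linearr R N M n) (fun m => @tensor_pure_linearl R N M m).

HB.instance Definition _ M N :=
  GRing.isLinear.Build R (tensor M N) (tensor N M) *:%R (@tswap M N)
    (linearP (tlift (b := fun m n => tensor_pure n m)
    (fun n => @tensor_pure_linearr R N M n) (fun m => @tensor_pure_linearl R N M m))).

Lemma tswapE M N (m : M) (n : N) : tswap (tensor_pure m n) = tensor_pure n m.
Proof.
exact: (tliftE (fun n => @tensor_pure_linearr R N M n)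
  (fun m => @tensor_pure_linearl R N M m)).
Qed.

Lemma tswapK M N (u : tensor M N) : tswap (tswap u) = u.
Proof.
apply: (eq_tensor (f := comp_lin (@tswap M N) (@tswap N M)) (g := idl _)) => m n.
by rewrite /= !tswapE.
Qed.

Lemma tswap_map M A B (f : {linear A -> B}) (u : tensor M A) :
  tswap (tensor_map M f u) = tensor_mapl f (tswap u).
Proof.
apply: (eq_tensor (f := comp_lin (tensor_map M f) (@tswap M B))
  (g := comp_lin (@tswap M A) (@tensor_mapl _ _ f M))) => m n.
by rewrite /= tensor_mapE !tswapE tensor_maplE.
Qed.

Lemma tensor_map_surj M A B (f : {linear A -> B}) :
  (forall z, exists y, f y = z) -> forall z, exists y, tensor_map M f y = z.
Proof.
move=> fs; apply: tensor_ind => [c u v [x <-] [y <-]|m n].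
  by exists (c *: x + y); rewrite linearP.
by have [x <-] := fs n; exists (tensor_pure m x); rewrite tensor_mapE.
Qed.

(* The inverse of [M (x) B / im -> M (x) C] is the bilinear map sending [(m, c)]
   to the class of [m (x) b] for any preimage [b] of [c]. *)
Lemma tensor_map_exact M A B C (f : {linear A -> B}) (g : {linear B -> C}) :
  exact_at f g -> (forall z, exists y, g y = z) ->
  exact_at (tensor_map M f) (tensor_map M g).
Proof.
move=> ex gs y; split=> [gy|[x <-]]; last first.
  have gf0 v : g (f v) = null_lin A C v by apply/ex; exists v.
  have := tensor_map_comp (M := M) gf0 x; rewrite (tensor_map0 (f := null_lin A C))//.
have [s sE] := choice gs.
pose S := im (tensor_map M f).
pose b m c := quot_pi S (tensor_pure m (s c)).
have bE m z : b m (g z) = quot_pi S (tensor_pure m z).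
  apply/quot_piP; rewrite -(linearB (purer B m)) /=.
  have /ex[x <-] : g (s (g z) - z) = 0 by rewrite linearB sE subrr.
  by apply/imP; exists (tensor_pure m x); rewrite /= tensor_mapE.
have bl c : linear (b^~ c).
  by move=> r m m'; rewrite /b tensor_pure_linearl linearP.
have br m : linear (b m).
  move=> r c c'; have [[z <-] [z' <-]] := (gs c, gs c').
  by rewrite -linearP !bE tensor_pure_linearr linearP.
apply/imP/quot_pi0; rewrite -(linear0 (tlift bl br)) -gy.
apply: (eq_tensor (f := quot_pi S) (g := comp_lin (tensor_map M g) (tlift bl br))).
by move=> m z; rewrite /= tensor_mapE tensor_liftE// bE.
Qed.

Lemma tensor_mapl_surj N A B (f : {linear A -> B}) :
  (forall z, exists y, f y = z) -> forall z : tensor B N, exists y, tensor_mapl f y = z.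
Proof.
move=> fs z; have [y yE] := tensor_map_surj (M := N) fs (tswap z).
by exists (tswap y); rewrite -tswap_map yE tswapK.
Qed.

Lemma tswap_mapl N A B (f : {linear A -> B}) (u : tensor A N) :
  tswap (tensor_mapl f u) = tensor_map N f (tswap u).
Proof. by rewrite -[RHS]tswapK tswap_map tswapK. Qed.

Lemma tensor_mapl_exact N A B C (f : {linear A -> B}) (g : {linear B -> C}) :
  exact_at f g -> (forall z, exists y, g y = z) ->
  exact_at (@tensor_mapl _ _ f N) (@tensor_mapl _ _ g N).
Proof.
move=> ex gs y /=; have /= := tensor_map_exact (M := N) ex gs (tswap y).
rewrite -tswap_mapl => -[h1 h2]; split=> [gy|[x E]].
  have [|x xE] := h1; first by rewrite gy linear0.
  by exists (tswap x); rewrite -tswap_map xE tswapK.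
rewrite -[LHS]tswapK h2 ?linear0//; exists (tswap x).
by rewrite -tswap_mapl E.
Qed.

End TensorBasics.

(** * Vanishing of Tor and flatness *)

Section FreeModules.
Variable R : comNzRingType.
Implicit Types (A B C M N X Y : lmodType R) (K : choiceType).

Lemma freegZ K (c : R) (k : K) : << c *g k >> = c *: << k >> :> {freeg K / R}.
Proof. by apply/eqP/freeg_eqP => z; rewrite coeffZ !coeffU mul1r. Qed.

Lemma fcoord_linearl X K (k : K) (z : {freeg K / R}) :
  linear (fun x : X => coeff k z *: x).
Proof. exact: scale_linear. Qed.

Lemma fcoord_linearr X K (k : K) (x : X) :
  linear (fun z : {freeg K / R} => coeff k z *: x).
Proof. by move=> c z z'; rewrite coeffD coeffZ scalerDl scalerA. Qed.

(** The coordinate at [k] under the identification of [X (x) R^(K)] with the direct sum of copies of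
    [X]. *)
Definition fcoord X K (k : K) : tensor X {freeg K / R} -> X :=
  tlift (fcoord_linearl k) (fun x => fcoord_linearr k x).

HB.instance Definition _ X K (k : K) :=
  GRing.isLinear.Build R (tensor X {freeg K / R}) X *:%R (@fcoord X K k)
    (linearP (tlift (fcoord_linearl k) (fun x => fcoord_linearr k x))).

Lemma fcoordE X K (k : K) (x : X) (z : {freeg K / R}) :
  fcoord k (tensor_pure x z) = coeff k z *: x.
Proof. exact: (tliftE (fcoord_linearl k) (fun x => fcoord_linearr k x)). Qed.

(** Every duplicate-free list containing the support is allowed, so that the supports of two
    summands can be merged. *)
Lemma tensor_freegE X K (u : tensor X {freeg K / R}) :
  exists D : seq K, forall D' : seq K, uniq D' -> {subset D <= D'} ->
    u = \sum_(k <- D') tensor_pure (fcoord k u) << k >>.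
Proof.
elim/tensor_ind: u => [c u v [D uE] [D' vE]|x z].
  exists (D ++ D') => E uqE DE.
  have DE1 : {subset D <= E} by move=> k kD; apply: DE; rewrite mem_cat kD.
  have DE2 : {subset D' <= E} by move=> k kD; apply: DE; rewrite mem_cat kD orbT.
  under eq_bigr => k _ do rewrite linearP tensor_pure_linearl.
  by rewrite big_split -scaler_sumr -(uE E) -?(vE E).
exists (dom z) => D' uqD zD.
under eq_bigr => k _ do rewrite fcoordE tensor_pureZ -freegZ.
rewrite -(linear_sum (purer {freeg K / R} x)) /=; congr tensor_pure.
rewrite -[LHS]freeg_sumE [RHS](bigID (mem (dom z)) xpredT) /= [X in _ + X]big1 ?addr0.
  rewrite -[RHS]big_filter; apply: perm_big; apply: uniq_perm.
  - exact: uniq_dom.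
  - exact: filter_uniq.
  by move=> k; rewrite mem_filter; case: (boolP (k \in dom z)) => // /zD ->.
by move=> k kz; rewrite coeff_outdom// freegU0.
Qed.

Lemma fcoord_eq0 X K (u : tensor X {freeg K / R}) :
  (forall k, fcoord k u = 0) -> u = 0.
Proof.
move=> u0; have [D /(_ (undup D))->] := tensor_freegE u.
- by rewrite big1// => k _; rewrite u0; exact: (linear0 (purel X << k >>)).
- exact: undup_uniq.
- by move=> k; rewrite mem_undup.
Qed.

Lemma fcoord_finite X K (u : tensor X {freeg K / R}) :
  exists D : seq K, forall k, k \notin D -> fcoord k u = 0.
Proof.
have [D h] := tensor_freegE u; exists (undup D) => k kD.
rewrite [in LHS](h (undup D)) ?undup_uniq//; last by move=> ?; rewrite mem_undup.
rewrite linear_sum big1_seq// => l /andP[_ lD].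
rewrite /= fcoordE coeffU; case: eqVneq => [lk|_]; last by rewrite mulr0 scale0r.
by rewrite -lk lD in kD.
Qed.

Lemma fcoord_mapl A B (f : {linear A -> B}) K (k : K)
    (u : tensor A {freeg K / R}) :
  fcoord k (tensor_mapl f u) = f (fcoord k u).
Proof.
apply: (eq_tensor (f := comp_lin (@tensor_mapl R _ _ f _) (@fcoord B K k))
  (g := comp_lin (@fcoord A K k) f)) => a z.
by rewrite /= tensor_maplE !fcoordE linearZZ.
Qed.

(** Tensoring with a free module is taking a direct sum: the coordinates of the image are the images
    of the coordinates. *)
Lemma tensor_mapl_freeg_inj A B (f : {linear A -> B}) K : injective f ->
  injective (@tensor_mapl R _ _ f {freeg K / R}).
Proof.
move=> fi; apply: lin_inj => u fu; apply: fcoord_eq0 => k.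
by apply: (inj0 fi); rewrite -fcoord_mapl fu linear0.
Qed.

Lemma tensor_map_freeg_inj A B (f : {linear A -> B}) K : injective f ->
  injective (tensor_map {freeg K / R} f).
Proof.
move=> fi; apply: lin_inj => u /= fu.
rewrite -[u]tswapK; suff -> : tswap u = 0 by rewrite linear0.
apply: (inj0 (tensor_mapl_freeg_inj (K := K) fi)).
by rewrite /= -tswap_map fu linear0.
Qed.

Definition cov N : {linear {freeg N / R} -> N} := free_lift (fun x : N => x).

Lemma covE N (x : N) : cov N << x >> = x.
Proof. exact: free_liftE. Qed.

Lemma cov_surj N (x : N) : exists y, cov N y = x.
Proof. by exists << x >>; exact: covE. Qed.

Definition syz N : lmodType R := submod (ker (cov N)).

Definition syz_inc N : {linear syz N -> {freeg N / R}} := val_lin (ker (cov N)).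

Lemma syz_ses N : ses (syz_inc N) (cov N).
Proof. exact: ses_ker (@cov_surj N). Qed.

End FreeModules.

Section TorVanishing.
Variable R : comNzRingType.
Implicit Types (A B C M N X Y : lmodType R) (K : choiceType).

(** The cover being free, Tor_1(X, N) is the kernel of [X (x) syz N -> X (x) F], where [F] is the
    free module on [N]. *)
Definition tor1_van N X := injective (tensor_map X (syz_inc N)).

(* [tor_van j N X] says that Tor_j(X, N) = 0, computed by resolving [N]. *)
Definition tor_van j N X : Prop :=
  if j is j'.+1 then tor1_van (iter j' (@syz R) N) X else zero_module (tensor X N).

Section ShortExact.
Variables (A B C : lmodType R) (f : {linear A -> B}) (g : {linear B -> C}).
Hypothesis fg : ses f g.

Let gs : forall z, exists y, g y = z. Proof. by case: fg. Qed.

Let cov_exact N X : exact_at (tensor_map X (syz_inc N)) (tensor_map X (cov N)).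
Proof. by case: (syz_ses N) => _ ex s; exact: tensor_map_exact. Qed.

Let row_exact N : exact_at (@tensor_mapl R _ _ f N) (@tensor_mapl R _ _ g N).
Proof. by case: fg => _ ex s; exact: tensor_mapl_exact. Qed.

Let row_inj K : injective (@tensor_mapl R _ _ f {freeg K / R}).
Proof. by apply: tensor_mapl_freeg_inj; case: fg. Qed.

(** Exactness of [Tor_1(C, N) -> A (x) N -> B (x) N], chased through the rows at [syz N], at the
    free cover and at [N]; the row at the free cover is injective on the left. *)
Lemma tor1_mapl_inj N : tor1_van N C -> injective (@tensor_mapl R _ _ f N).
Proof.
move=> vC; apply: lin_inj => u /= fu.
have [u1 u1E] := tensor_map_surj (M := A) (@cov_surj R N) u.
have /cov_exact[w wE] : tensor_map B (cov N) (tensor_mapl f u1) = 0.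
  by rewrite tensor_map_comm u1E.
have /row_exact[w' w'E] : tensor_mapl g w = 0.
  apply: (inj0 vC); rewrite /= tensor_map_comm [tensor_map _ _ _]wE.
  by apply/row_exact; exists u1.
suff u1w : u1 = tensor_map A (syz_inc N) w'.
  by rewrite -u1E; apply/cov_exact; exists w'.
by apply: (@row_inj N); rewrite /= -tensor_map_comm [tensor_mapl f w']w'E -wE.
Qed.

(** The preceding portion [Tor_1(B, N) -> Tor_1(C, N) -> A (x) N -> B (x) N] of the long exact
    sequence. *)
Lemma mapl_inj_tor1 N : injective (@tensor_mapl R _ _ f N) -> tor1_van N B ->
  tor1_van N C.
Proof.
move=> fi vB; apply: lin_inj => w /= w0.
have [w1 w1E] := tensor_mapl_surj gs w.
have /row_exact[u uE] : tensor_mapl g (tensor_map B (syz_inc N) w1) = 0.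
  by rewrite -tensor_map_comm w1E.
have /cov_exact[w2 w2E] : tensor_map A (cov N) u = 0.
  apply: (inj0 fi); rewrite /= -tensor_map_comm [tensor_mapl f u]uE.
  by apply/cov_exact; exists w1.
rewrite -w1E; apply/row_exact; exists w2; apply: vB.
by rewrite /= tensor_map_comm [tensor_map _ _ w2]w2E.
Qed.

Lemma tor_van_mid j N : tor_van j N A -> tor_van j N C -> tor_van j N B.
Proof.
case: j => [|j] /= vA vC.
  move=> u; have /row_exact[w <-] : tensor_mapl g u = 0 by exact: vC.
  by rewrite [w]vA linear0.
apply: lin_inj => w /= w0.
have /row_exact[w1 w1E] : tensor_mapl g w = 0.
  by apply: (inj0 vC); rewrite /= tensor_map_comm w0 linear0.
rewrite -w1E; suff -> : w1 = 0 by rewrite linear0.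
apply: (inj0 vA); apply: (@row_inj _).
by rewrite /= -tensor_map_comm [tensor_mapl f w1]w1E w0 linear0.
Qed.

(** For [j > 0] let [K] be the [j]-th syzygy of [N], inside the free module [F]. Vanishing at [C]
    makes [A (x) K -> B (x) K] injective, vanishing at [B] makes [B (x) K -> B (x) F] injective, and
    the composite factors through [A (x) K -> A (x) F]. *)
Lemma tor_van_left j N : tor_van j N B -> tor_van j.+1 N C -> tor_van j N A.
Proof.
case: j => [|j] /= vB vC.
  by move=> u; apply: (inj0 (tor1_mapl_inj vC)); exact: vB.
apply: lin_inj => w /= w0.
apply: (inj0 (tor1_mapl_inj vC)); apply: (inj0 vB).
by rewrite /= tensor_map_comm w0 linear0.
Qed.

(** The connecting map lands in Tor_j(A, N). For [j > 0] and [K], [F] as above, vanishing there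
    embeds [A (x) K] into [A (x) F], hence into [B (x) F], so [A (x) K -> B (x) K] is injective. *)
Lemma tor_van_right j N : tor_van j.+1 N B -> tor_van j N A -> tor_van j.+1 N C.
Proof.
case: j => [|j] /= vB vA.
  by apply: mapl_inj_tor1 => // u v _; rewrite [u]vA [v]vA.
apply: mapl_inj_tor1 => //; apply: lin_inj => w /= fw.
apply: (inj0 vA); apply: (@row_inj _).
by rewrite /= -tensor_map_comm fw !linear0.
Qed.

End ShortExact.

(** [flat] speaks of exactness at the middle of any two maps. Corestricting [g] to its image brings
    right exactness into play, and the inclusion of the image stays injective after tensoring. *)
Lemma injective_flat X :
  (forall A B (f : {linear A -> B}), injective f -> injective (tensor_map X f)) ->
  flat X.
Proof.
move=> h A B C f g ex.
have gI x : g x \in im g by apply/imP; exists x.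
pose g' := corestrict_lin gI.
have ex' : exact_at f g'.
  move=> y; rewrite -ex; split=> [/(congr1 val)//|gy]; exact: val_inj.
have gs' z : exists y, g' y = z.
  by have /imP[y yE] := submod_valP z; exists y; exact: val_inj.
have ii : injective (tensor_map X (val_lin (im g))) by apply: h; exact: val_inj.
have gE u : tensor_map X (val_lin (im g)) (tensor_map X g' u) = tensor_map X g u.
  exact: (tensor_map_comp (f := g') (g := val_lin (im g))).
move=> y; rewrite -(tensor_map_exact (M := X) ex' gs' y) /=; split=> y0.
  by apply: (inj0 ii); rewrite /= gE.
by rewrite -gE y0 linear0.
Qed.

Lemma flat_injective X A B (f : {linear A -> B}) :
  flat X -> injective f -> injective (tensor_map X f).
Proof.
move=> fX fi; apply: lin_inj => u fu.
have ex : exact_at (null_lin A A) f.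
  by move=> y; split=> [/(inj0 fi)->|[x <-]]; [exists 0|exact: linear0].
have [/(_ fu)[w <-] _] := fX _ _ _ _ _ ex u.
exact: (tensor_map0 (f := null_lin A A)).
Qed.

Lemma flat_tor X j N : flat X -> tor_van j.+1 N X.
Proof. move=> fX; apply: flat_injective => //; exact: val_inj. Qed.

(* Both [X (x) A -> X (x) B] and [X (x) syz N -> X (x) F] for [N = B / A], [F] the
   free cover of [N], are compared through [0 -> syz N -> F * A -> B -> 0]. *)
Lemma tor1_flat X : (forall N, tor1_van N X) -> flat X.
Proof.
move=> vX; apply: injective_flat => A B i ii; apply: lin_inj => u /= iu.
set N := quotmod (im i) : lmodType R; pose p := quot_pi (im i) : {linear B -> N}.
pose phi : {linear {freeg N / R} -> B} := free_lift (fun z : N => repr z).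
have pphi z : p (phi z) = cov N z.
  rewrite -[z]freeg_sumE !linear_sum /=; apply: eq_bigr => k _.
  rewrite freegZ !linearZZ; congr (_ *: _).
  rewrite /phi /= free_liftE; apply: etrans (esym (covE k)); exact: quot_reprK.
(* [phi] lifts the cover of [B / A] to [B], so it sends syzygies into the image of [i]. *)
have [|psi psiE] := factor_inj (h := comp_lin (syz_inc N) phi) ii.
  move=> w; apply/imP/quot_pi0; apply: etrans (pphi _) _.
  by have [_ ex _] := syz_ses N; apply/ex; exists w.
pose al := pair_lin (syz_inc N) (opp_lin psi).
pose be : {linear ({freeg N / R} * A)%type -> B} :=
  add_lin (comp_lin (fst_lin _ A) phi) (comp_lin (snd_lin _ A) i).
have ex : exact_at al be.
  move=> [z y]; split=> [/= e|[w [<- <-]] /=]; last by rewrite linearN psiE subrr.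
  have e' : phi z = - i y by apply/eqP; rewrite -addr_eq0; apply/eqP.
  have [_ exN _] := syz_ses N; have /exN[w wE] : cov N z = 0.
    rewrite -pphi e' linearN; apply/eqP; rewrite oppr_eq0; apply/eqP.
    by apply/quot_pi0/imP; exists y.
  have psiw := psiE w; rewrite comp_linE wE e' in psiw.
  by exists w; congr (_, _) => //; apply: ii; rewrite linearN psiw opprK.
have bs y : exists z, be z = y.
  have /quot_pi0/imP[x xE] : p (y - phi << p y >>) = 0.
    by rewrite linearB pphi covE subrr.
  by exists (<< p y >>, x); rewrite /= xE addrC subrK.
pose inr := pair_lin (null_lin A {freeg N / R}) (idl A).
have /(tensor_map_exact (M := X) ex bs)[w wE] :
    tensor_map X be (tensor_map X inr u) = 0.
  rewrite -iu; apply: (tensor_map_comp (f := inr) (g := be)) => x /=.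
  by rewrite linear0 add0r.
(* The component of [inr] in the free module is zero, so the image of [w] in [X (x) F] is zero. *)
have w0 : w = 0.
  apply: (inj0 (vX N)) => /=.
  have <- : tensor_map X (fst_lin _ A) (tensor_map X al w) = tensor_map X (syz_inc N) w.
    exact: (tensor_map_comp (f := al) (g := fst_lin _ A)).
  rewrite [tensor_map X al w]wE.
  rewrite (tensor_map_comp (f := inr) (g := fst_lin _ A) (h := null_lin A _))//.
  exact: tensor_map0.
have <- : tensor_map X (snd_lin _ A) (tensor_map X inr u) = u.
  rewrite (tensor_map_comp (f := inr) (g := snd_lin _ A) (h := idl A))//.
  exact: tensor_map_id.
by rewrite -wE w0 !linear0.
Qed.

Lemma flat_freeg K : flat {freeg K / R}.
Proof. by apply: injective_flat => A B f; exact: tensor_map_freeg_inj. Qed.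

End TorVanishing.

(** * Flat resolutions *)

Section TorClosure.
Variable R : comNzRingType.
Implicit Types (A B C M N P X Y : lmodType R) (K : choiceType).

Lemma tensor_zerol X N : zero_module X -> zero_module (tensor X N).
Proof.
move=> X0; elim/tensor_ind => [c u v -> ->|x n]; first by rewrite linear0 addr0.
by rewrite (X0 x); exact: (linear0 (purel X n)).
Qed.

Lemma tensor_zeror X N : zero_module N -> zero_module (tensor X N).
Proof. by move=> N0 u; rewrite -[u]tswapK (tensor_zerol N0 (tswap u)) linear0. Qed.

Lemma zero_tor_van j N X : zero_module X -> tor_van j N X.
Proof.
move=> X0; case: j => [|j] /=; first exact: tensor_zerol.
by move=> u v _; rewrite [u](tensor_zerol X0) [v](tensor_zerol X0).
Qed.

Lemma tor_van_prod j N A B :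
  tor_van j N A -> tor_van j N B -> tor_van j N (A * B)%type.
Proof.
apply: (@tor_van_mid _ A (A * B)%type B (pair_lin (idl A) (null_lin A B)) (snd_lin A B)).
split=> [x y []|[x y]|y] //; last by exists (0, y).
split=> [/= ->|[z [_ <-]]//]; by exists x.
Qed.

Definition zmod0 : lmodType R := 'rV[R]_0.

Lemma zmod0_zero : zero_module zmod0.
Proof. by move=> x; rewrite [LHS]thinmx0. Qed.

Lemma tensor_assoc_linearl P M N (n : N) :
  linear (fun t : tensor P M => tensor_map P (purel M n) t).
Proof. by move=> c x y; rewrite linearP. Qed.

Lemma tensor_assoc_linearr P M N (t : tensor P M) :
  linear (fun n : N => tensor_map P (purel M n) t).
Proof.
elim/tensor_ind: t => [c u v IHu IHv|p m].
  have E n : tensor_map P (purel M n) (c *: u + v) =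
      c *: tensor_map P (purel M n) u + tensor_map P (purel M n) v by exact: linearP.
  by move=> d x y; rewrite !E IHu IHv !scalerDr !scalerA [d * c]mulrC addrACA.
move=> c x y; rewrite !tensor_mapE.
by rewrite -tensor_pure_linearr; congr tensor_pure; exact: tensor_pure_linearr.
Qed.

Definition tensor_assoc P M N : tensor (tensor P M) N -> tensor P (tensor M N) :=
  tlift (@tensor_assoc_linearl P M N) (@tensor_assoc_linearr P M N).

HB.instance Definition _ P M N :=
  GRing.isLinear.Build R (tensor (tensor P M) N) (tensor P (tensor M N)) *:%R
    (@tensor_assoc P M N)
    (linearP (tlift (@tensor_assoc_linearl P M N) (@tensor_assoc_linearr P M N))).

Lemma tensor_assocE P M N (p : P) (m : M) (n : N) :
  tensor_assoc (tensor_pure (tensor_pure p m) n) = tensor_pure p (tensor_pure m n).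
Proof.
apply: etrans (tliftE (@tensor_assoc_linearl P M N) (@tensor_assoc_linearr P M N) _ _) _.
by rewrite tensor_mapE.
Qed.

Lemma tensor_unassoc_linearl P M N (v : tensor M N) :
  linear (fun p : P => tensor_mapl (purer M p) v).
Proof.
elim/tensor_ind: v => [c u v IHu IHv|m n].
  have E p : tensor_mapl (purer M p) (c *: u + v) =
      c *: tensor_mapl (purer M p) u + tensor_mapl (purer M p) v by exact: linearP.
  by move=> d x y; rewrite !E IHu IHv !scalerDr !scalerA [d * c]mulrC addrACA.
move=> c x y; rewrite !tensor_maplE.
rewrite -tensor_pure_linearl; congr tensor_pure; exact: tensor_pure_linearl.
Qed.

Lemma tensor_unassoc_linearr P M N (p : P) :
  linear (fun v : tensor M N => tensor_mapl (purer M p) v).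
Proof. by move=> c x y; rewrite linearP. Qed.

Lemma tensor_assoc_inj P M N : injective (@tensor_assoc P M N).
Proof.
pose un := tlift (@tensor_unassoc_linearl P M N) (@tensor_unassoc_linearr P M N).
apply: (can_inj (g := un)).
elim/tensor_ind=> [c u v IHu IHv|t n]; first by rewrite !linearP IHu IHv.
elim/tensor_ind: t => [c u v IHu IHv|p m]; last first.
  rewrite tensor_assocE.
  apply: etrans (tliftE (@tensor_unassoc_linearl P M N) (@tensor_unassoc_linearr P M N) _ _) _.
  by rewrite tensor_maplE.
by rewrite tensor_pure_linearl !linearP IHu IHv.
Qed.

Lemma tensor_assoc_map P M A B (f : {linear A -> B}) u :
  tensor_assoc (tensor_map (tensor P M) f u) =
  tensor_map P (tensor_map M f) (tensor_assoc u).
Proof.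
pose l := comp_lin (tensor_map (tensor P M) f) (@tensor_assoc P M B).
pose r := comp_lin (@tensor_assoc P M A) (tensor_map P (tensor_map M f)).
apply: (eq_tensor (f := l) (g := r)) => t n.
apply: (eq_tensor (f := comp_lin (purel _ n) l) (g := comp_lin (purel _ n) r)) => p m.
by rewrite /= tensor_mapE !tensor_assocE tensor_mapE /= tensor_mapE.
Qed.

(** Up to associativity the map is [P (x) (M (x) f)]. For all injective [f] this gives flatness of
    [P (x) M]; for a syzygy inclusion it gives vanishing of Tor. *)
Lemma tensor_map_inj P M A B (f : {linear A -> B}) : flat P ->
  injective (tensor_map M f) -> injective (tensor_map (tensor P M) f).
Proof.
move=> fP fi; apply: lin_inj => u /= fu; apply: (@tensor_assoc_inj P M A).
apply: (flat_injective fP fi).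
by rewrite /= -tensor_assoc_map fu !linear0.
Qed.

Lemma flat_tensor P M : flat P -> flat M -> flat (tensor P M).
Proof.
move=> fP fM; apply: injective_flat => A B f fi.
exact/tensor_map_inj/(flat_injective fM).
Qed.

Lemma tor_van_tensor P M j N : flat P -> tor_van j.+1 N M -> tor_van j.+1 N (tensor P M).
Proof. by move=> fP; exact: tensor_map_inj. Qed.

End TorClosure.

Section FlatResolutions.
Variable R : comNzRingType.
Implicit Types (A B C M N P X Y : lmodType R).

Lemma flat_resolution0 X : flat X -> has_flat_resolution_of_length X 0.
Proof.
move=> fX.
pose o i : lmodType R := if i is 0%N then X else zmod0 R.
have oS i (x y : o i.+1) : x = y by rewrite (zmod0_zero x) (zmod0_zero y).
have fo i : flat (o i).
  case: i => //= i; apply: tor1_flat => N.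
  by have := @zero_tor_van R 1 N _ (@zmod0_zero R).
unshelve eexists (@FlatResolution R X o (fun i => null_lin _ _) (idl X) fo _ _ _).
- by move=> x; exists x.
- by move=> y; split=> [/= ->|[x <-]]//; exists 0.
- by move=> i y; split=> _ //; exists 0; exact: oS.
by case=> // i _ x; exact: oS.
Qed.

Lemma flat_resolutionS d X (F : lmodType R) (f : {linear F -> X}) : flat F ->
  (forall z, exists y, f y = z) ->
  has_flat_resolution_of_length (submod (ker f)) d ->
  has_flat_resolution_of_length X d.+1.
Proof.
move=> fF fs [K Kd].
pose o i : lmodType R := if i is j.+1 then fres_obj K j else F.
pose df i : {linear o i.+1 -> o i} :=
  match i with
  | 0%N => comp_lin (fres_aug K) (val_lin (ker f))
  | j.+1 => fres_diff K j
  end.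
have fo i : flat (o i) by case: i => //= i; exact: fres_flat.
have ex0 : exact_at (df 0%N) f.
  have [_ ex _] := ses_ker fs.
  move=> y; rewrite ex; split=> -[x <-]; last by exists (fres_aug K x).
  by have [z <-] := fres_surj K x; exists z.
have ex i : exact_at (df i.+1) (df i).
  case: i => [|i] y; last exact: fres_exact.
  rewrite -(@fres_exact0 _ _ K y); split=> [y0|/= ->//].
  exact: (inj0 (f := val_lin (ker f)) (@val_inj _ _ _)).
by exists (@FlatResolution R X o df f fo fs ex0 ex); case=> // i; exact: Kd.
Qed.

(** Passing to the kernel of the free cover lowers the degree by one, down to degree 1, where
    vanishing for all [N] is flatness. *)
Lemma tor_flat_resolution d X : (forall N, tor_van d.+1 N X) ->
  has_flat_resolution_of_length X d.
Proof.
elim: d X => [|d IH] X vX; first exact/flat_resolution0/tor1_flat.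
apply: (flat_resolutionS (f := cov X)); [exact: flat_freeg|exact: cov_surj|].
apply: IH => N; apply: (tor_van_left (syz_ses X)) => //.
exact/flat_tor/flat_freeg.
Qed.

(** Dropping the term of degree 0 leaves a resolution of the kernel of the augmentation, shorter by
    one; in length 0 the augmentation is an isomorphism. *)
Lemma flat_resolution_tor d X j N : has_flat_resolution_of_length X d -> (d < j)%N ->
  tor_van j N X.
Proof.
move=> [F Fd]; case: j => // j; rewrite ltnS.
elim: d X F Fd j => [|d IH] X F Fd j dj.
  have augi : injective (fres_aug F).
    apply: lin_inj => x /fres_exact0[y <-].
    by rewrite (Fd 1%N isT y) linear0.
  have augs := fres_surj F.
  apply: (tor_van_right (f := null_lin (zmod0 R) _) (g := fres_aug F)).
  - split=> //; first by move=> x y _; rewrite (zmod0_zero x) (zmod0_zero y).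
    by move=> y; split=> [/(inj0 augi)->|[x <-]]; [exists 0|rewrite linear0].
  - exact/flat_tor/fres_flat.
  - exact/zero_tor_van/zmod0_zero.
case: j dj => // j dj.
apply: (tor_van_right (ses_ker (fres_surj F))); first exact/flat_tor/fres_flat.
have aK x : fres_diff F 0%N x \in ker (fres_aug F).
  by rewrite mem_ker; apply/eqP/fres_exact0; exists x.
pose ag := corestrict_lin aK.
have ags x : exists y, ag y = x.
  have : fres_aug F (submod_val x) = 0 by apply/eqP; case: x.
  by move=> /fres_exact0[y yE]; exists y; exact: val_inj.
have ex0 : exact_at (fres_diff F 1%N) ag.
  move=> y; rewrite -(@fres_exact _ _ F 0%N y); split=> [/(congr1 val)//|y0].
  exact: val_inj.
pose F' : flat_resolution (submod (ker (fres_aug F))) :=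
  @FlatResolution R _ (fun i => fres_obj F i.+1) (fun i => fres_diff F i.+1)
    ag (fun i => @fres_flat _ _ F i.+1) ags ex0 (fun i => @fres_exact _ _ F i.+1).
exact: (IH _ F' (fun i => Fd i.+1)).
Qed.

End FlatResolutions.

(** * Localization at an element *)

Section Localization.
Variable R : comNzRingType.
Implicit Types (A B C M N P X Y : lmodType R) (K : choiceType).

Lemma freeg_lin_ind K (P : {freeg K / R} -> Prop) : P 0 ->
  (forall c u v, P u -> P v -> P (c *: u + v)) -> (forall k, P << k >>) ->
  forall z, P z.
Proof.
move=> P0 PD Pk z; rewrite -[z]freeg_sumE.
elim: (dom z) => [|k s IH]; first by rewrite big_nil.
by rewrite big_cons freegZ; exact: PD.
Qed.

Lemma freeg_lin_ext K M (f g : {linear {freeg K / R} -> M}) :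
  (forall k, f << k >> = g << k >>) -> forall z, f z = g z.
Proof.
move=> h; apply: freeg_lin_ind => //; first by rewrite !linear0.
by move=> c u v; rewrite !linearP => -> ->.
Qed.

Variable x : R.

(* [R_x] is presented by generators [<< k >>], standing for [x ^- k], and relations
   [<< k >> = x << k.+1 >>]. *)
Definition loc_rel : {linear {freeg nat / R} -> {freeg nat / R}} :=
  free_lift (fun k => << k >> - x *: << k.+1 >>).

(** As the cokernel of a map of free modules it can be handled in coordinates, which yield both its
    flatness and the kernel of [M -> M_x]. *)
Definition locR : lmodType R := quotmod (im loc_rel).

Definition loc_gen (k : nat) : locR := quot_pi (im loc_rel) << k >>.

Definition lcoord N (k : nat) : {linear tensor {freeg nat / R} N -> N} :=
  comp_lin (@tswap R {freeg nat / R} N) (@fcoord R N nat k).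

Lemma lcoordE N k (z : {freeg nat / R}) (n : N) :
  lcoord N k (tensor_pure z n) = coeff k z *: n.
Proof. by rewrite /= tswapE fcoordE. Qed.

Lemma lcoord_eq0 N (u : tensor {freeg nat / R} N) :
  (forall k, lcoord N k u = 0) -> u = 0.
Proof.
by move=> u0; rewrite -[u]tswapK (fcoord_eq0 (u := tswap u)) ?linear0.
Qed.

Lemma lcoord0_rel N (u : tensor {freeg nat / R} N) :
  lcoord N 0 (tensor_mapl loc_rel u) = lcoord N 0 u.
Proof.
apply: (eq_tensor (f := comp_lin (@tensor_mapl R _ _ loc_rel N) (lcoord N 0))) => z n.
rewrite comp_linE [X in lcoord _ _ X]tensor_maplE.
apply: (freeg_lin_ext (f := comp_lin loc_rel (comp_lin (purel _ n) (lcoord N 0)))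
  (g := comp_lin (purel _ n) (lcoord N 0))) => k.
rewrite /= free_liftE !tswapE !fcoordE coeffB coeffZ !coeffU.
by rewrite mulr0 mulr0 subr0.
Qed.

Lemma lcoordS_rel N k (u : tensor {freeg nat / R} N) :
  lcoord N k.+1 (tensor_mapl loc_rel u) = lcoord N k.+1 u - x *: lcoord N k u.
Proof.
pose r := add_lin (lcoord N k.+1)
  (opp_lin (comp_lin (lcoord N k) (mklin (@scale_linear R N x)))).
apply: (eq_tensor (g := r)
  (f := comp_lin (@tensor_mapl R _ _ loc_rel N) (lcoord N k.+1))) => z n.
rewrite comp_linE [X in lcoord _ _ X]tensor_maplE.
apply: (freeg_lin_ext (f := comp_lin loc_rel (comp_lin (purel _ n) (lcoord N k.+1)))
  (g := comp_lin (purel _ n) r)) => j.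
rewrite /= free_liftE !tswapE !fcoordE coeffB coeffZ !coeffU.
by rewrite !mul1r eqSS scalerBl scalerA.
Qed.

(** In coordinates the map is [u_k -> u_k - x u_(k-1)] with [u_(-1) = 0], which is unitriangular. *)
Lemma loc_rel_tensor_inj N : injective (@tensor_mapl R _ _ loc_rel N).
Proof.
apply: lin_inj => u /= u0; apply: lcoord_eq0; elim=> [|k IH].
  by rewrite -lcoord0_rel u0 linear0.
by have := lcoordS_rel k u; rewrite u0 IH linear0 scaler0 subr0.
Qed.

Lemma loc_rel_inj : injective loc_rel.
Proof.
apply: lin_inj => z z0.
have : tensor_pure z (1 : R^o) = 0.
  apply: (inj0 (@loc_rel_tensor_inj R^o)); rewrite /= tensor_maplE z0.
  exact: (linear0 (purel _ (1 : R^o))).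
move=> z1; apply/eqP/freeg_eqP => k; rewrite coeff0.
by have := congr1 (lcoord R^o k) z1; rewrite lcoordE linear0 [_ *: _]mulr1.
Qed.

Lemma locR_ses : ses loc_rel (quot_pi (im loc_rel)).
Proof. exact/ses_coker/loc_rel_inj. Qed.

(** The middle term of the presentation being free, Tor_1(R_x, N) is the kernel of the relation map
    tensored with [N]. *)
Lemma flat_locR : flat locR.
Proof.
apply: tor1_flat => N; apply: (mapl_inj_tor1 locR_ses); first exact: loc_rel_tensor_inj.
exact: (@flat_tor R _ 0 N (@flat_freeg R nat)).
Qed.

Lemma loc_genE n k : loc_gen k = x ^+ n *: loc_gen (k + n).
Proof.
elim: n => [|n IH]; first by rewrite scale1r addn0.
rewrite IH exprSr -scalerA addnS; congr (_ *: _).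
rewrite -linearZZ; apply/quot_piP/imP; exists << (k + n)%N >>; exact: free_liftE.
Qed.

Definition loc M : lmodType R := tensor locR M.

Definition to_loc M : {linear M -> loc M} := purer M (loc_gen 0).

Lemma loc_ind M (P : loc M -> Prop) :
  (forall c u v, P u -> P v -> P (c *: u + v)) ->
  (forall k m, P (tensor_pure (loc_gen k) m)) -> forall u, P u.
Proof.
move=> PD Pk; apply: tensor_ind => // r m.
have P0 : P 0 by have := PD (-1) _ _ (Pk 0%N m) (Pk 0%N m); rewrite scaleN1r addNr.
have [z <-] := quot_pi_surj r.
elim/freeg_lin_ind: z => [|c u v Pu Pv|k]; last exact: Pk.
  by rewrite linear0; move: P0; congr P; apply/esym; exact: (linear0 (purel _ m)).
by rewrite linearP tensor_pure_linearl; exact: PD.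
Qed.

Lemma to_loc_map A B (f : {linear A -> B}) m :
  tensor_map locR f (to_loc A m) = to_loc B (f m).
Proof. exact: tensor_mapE. Qed.

Lemma to_loc_eq0 M (m : M) : to_loc M m = 0 <-> exists p, x ^+ p *: m = 0.
Proof.
have [_ ex s] := locR_ses; split=> [m0|[p m0]].
  have /(tensor_mapl_exact (N := M) ex s)[u uE] :
      tensor_mapl (quot_pi (im loc_rel)) (tensor_pure << 0%N >> m) = 0.
    by rewrite tensor_maplE.
  (* The relations force the coordinates of [u] to be the multiples [x ^+ k *: m]; their support is
     finite, so some power of [x] kills [m]. *)
  have uk k : lcoord M k u = x ^+ k *: m.
    elim: k => [|k IH].
      by rewrite -lcoord0_rel [tensor_mapl _ _]uE lcoordE coeffU mul1r.
    have := lcoordS_rel k u; rewrite [tensor_mapl _ _]uE lcoordE coeffU mulr0 scale0r.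
    by move=> /esym/eqP; rewrite subr_eq0 => /eqP ->; rewrite IH scalerA exprS.
  have [D hD] := fcoord_finite (tswap u).
  (* This index exceeds every element of [D]. *)
  exists (\sum_(i <- D) i.+1)%N; rewrite -uk; apply: hD; apply/negP => iD.
  move: (leqnn (\sum_(i <- D) i.+1)%N).
  by rewrite {1}(big_rem _ iD) /= addSn ltnNge leq_addr.
rewrite /= (loc_genE p) tensor_pureZ m0; exact: (linear0 (purer M _)).
Qed.

(** The hypothesis says that each fraction [m / x^k] equals some [e / 1]. *)
Lemma to_loc_surj M :
  (forall k (m : M), exists e s, x ^+ s *: (x ^+ k *: e - m) = 0) ->
  forall u, exists e, to_loc M e = u.
Proof.
move=> h; apply: loc_ind => [c u v [e <-] [e' <-]|k m].
  by exists (c *: e + e'); rewrite linearP.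
have [e [s /eqP]] := h k m; rewrite scalerBr subr_eq0 scalerA -exprD => /eqP eE.
exists e; rewrite /= (loc_genE (s + k) 0) (loc_genE s k) !tensor_pureZ eE.
by rewrite add0n addnC.
Qed.

(** In degree 0, [m / x^k] is [x] times [m / x^(k+1)], and [x] moves across the tensor sign to kill
    [n]. Higher degrees shift along the localized free cover of [M], which is flat. *)
Lemma tor_van_loc j N M : (forall n : N, x *: n = 0) -> tor_van j N (loc M).
Proof.
move=> xN; elim: j M => [|j IH] M.
  apply: tensor_ind => [c u v -> ->|]; first by rewrite scaler0 addr0.
  move=> t n; elim/loc_ind: t => [c u v u0 v0|k m].
    by rewrite tensor_pure_linearl u0 v0 scaler0 addr0.
  have -> : tensor_pure (loc_gen k) m = x *: tensor_pure (loc_gen (k + 1)) m.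
    rewrite {1}(loc_genE 1 k) expr1; exact: (linearZZ (purel _ m)).
  rewrite tensor_pureZ xN; exact: (linear0 (purer _ _)).
have [fi ex s] := syz_ses M.
apply: (@tor_van_right _ _ _ _ (tensor_map locR (syz_inc M)) (tensor_map locR (cov M))).
- split; [exact: flat_injective flat_locR fi|exact: flat_locR|exact: tensor_map_surj].
- exact/flat_tor/flat_tensor/flat_freeg/flat_locR.
exact: IH.
Qed.

End Localization.

(** * Injectivity and torsion over Noetherian rings *)

Section Ideals.
Variables (R : comNzRingType) (b : ideal R).
Implicit Types u v c : R.

Lemma ideal0 : (0 : R) \in b. Proof. exact: rpred0. Qed.

Lemma idealD u v : u \in b -> v \in b -> u + v \in b. Proof. exact: rpredD. Qed.

Lemma idealB u v : u \in b -> v \in b -> u - v \in b. Proof. exact: rpredB. Qed.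

Lemma idealMl c u : u \in b -> c * u \in b. Proof. exact: rpredZ. Qed.

End Ideals.

(** * Maximal ideals and units of a local ring *)

Section LocalRings.
Variable R : comNzRingType.
Implicit Types (b c m : ideal R) (x : R).

Lemma proper_sub_maximal b : 1 \notin b ->
  exists m, maximal_ideal m /\ {subset b <= m}.
Proof.
move=> b1.
(* Only the union of [X] with [b] has to be an ideal: the empty chain, whose union is empty, is then
   covered by [b] itself. *)
pose P (X : set R) := exists J : ideal R,
  [/\ 1 \notin J, {subset b <= J} & forall z, z \in J <-> X z \/ z \in b].
have [|X [[J [J1 bJ JX]] Xmax]] := @Zorn_bigcup R P.
  move=> F FP Ftot.
  pose U : {pred R^o} := fun z => `[< (\bigcup_(X in F) X) z \/ z \in b >].
  have UJ y z : y \in U -> z \in U -> exists J : ideal R,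
      [/\ 1 \notin J, y \in J, z \in J & {subset J <= U}].
    have FU X (J : ideal R) : F X -> (forall z, z \in J <-> X z \/ z \in b) -> {subset J <= U}.
      move=> FX JX u /JX[Xu|ub]; apply/asboolP; last by right.
      by left; exists X.
    move=> /asboolP[[X FX Xy]|yb] /asboolP[[Y FY Yz]|zb].
    - have [XY|YX] := Ftot X Y FX FY.
        have [J [J1 bJ JY]] := FP _ FY; exists J.
        by split=> //; [apply/JY; left; exact: XY|apply/JY; left|exact: FU JY].
      have [J [J1 bJ JX]] := FP _ FX; exists J.
      by split=> //; [apply/JX; left|apply/JX; left; exact: YX|exact: FU JX].
    - have [J [J1 bJ JX]] := FP _ FX; exists J.
      by split=> //; [apply/JX; left|apply/JX; right|exact: FU JX].
    - have [J [J1 bJ JY]] := FP _ FY; exists J.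
      by split=> //; [apply/JY; right|apply/JY; left|exact: FU JY].
    by exists b; split=> // u ub; apply/asboolP; right.
  have Uc : submod_closed U.
    split=> [|d y z yU zU]; first by apply/asboolP; right; exact: rpred0.
    by have [J [_ yJ zJ]] := UJ y z yU zU; apply; rewrite rpredD// rpredZ.
  exists (Submodule Uc); split=> [|z zb|z]; last by split=> [/asboolP|h] //; apply/asboolP.
    by apply/negP => U1; have [J [/negP J1 ? _ _]] := UJ 1 1 U1 U1.
  by apply/asboolP; right.
exists J; split=> //; split=> // J' JJ' J'1 z zJ'; apply: contrapT => zJ.
apply: (Xmax [set` J']).
  split=> [u Xu|h]; first by apply: JJ'; apply/JX; left.
  by apply: zJ; apply/JX; left; exact: h.
have bJ' : {subset b <= J'} by move=> u /bJ /JJ'.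
by exists J'; split=> // u; split=> [|[|/bJ']]; [left| |].
Qed.

Lemma local_proper_sub m b : (forall m', maximal_ideal m' -> m' =i m) ->
  1 \notin b -> {subset b <= m}.
Proof.
by move=> mu /proper_sub_maximal[m' [/mu mm' bm']] z /bm'; rewrite mm'.
Qed.

Lemma local_unit m x : (forall m', maximal_ideal m' -> m' =i m) -> x \notin m ->
  exists y, y * x = 1.
Proof.
move=> mu xm; pose l : {linear R^o -> R^o} := mklin (@scale_linear R R^o x).
have [/imP[y yE]|l1] := boolP (1 \in im l); first by exists y; rewrite mulrC.
have /(local_proper_sub mu)/(_ x) : 1 \notin im l by [].
rewrite (negbTE xm) => h; have /h// : x \in im l.
by apply/imP; exists 1; exact: mulr1.
Qed.

End LocalRings.

(** * Uniform bounds and Baer's criterion for torsion submodules *)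

Section NoetherianTorsion.
Variable R : comNzRingType.
Hypothesis noethR : noetherian R.
Implicit Types (b : ideal R) (x : R).

(** Finitely many generators have a common index, and closure of [P n] spreads it over the ideal.
    This turns exponents depending on the element into a uniform one. *)
Lemma noeth_bound b (P : nat -> R -> Prop) :
  (forall n n' u, (n <= n')%N -> P n u -> P n' u) ->
  (forall n c u v, u \in b -> v \in b -> P n u -> P n v -> P n (c * u + v)) ->
  (forall n, P n 0) ->
  (forall u, u \in b -> exists n, P n u) -> exists n, forall u, u \in b -> P n u.
Proof.
move=> Pm PD P0 Pb; have [s sE] := noethR b.
have [n nP] : exists n, forall u, u \in s -> P n u.
  have sb u : u \in s -> u \in b by move=> us; rewrite sE; exact: mem_span.
  elim: s {sE} sb => [|v s IH] sb; first by exists 0%N.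
  have [u us|n nP] := IH; first by apply: sb; rewrite inE us orbT.
  have [n' n'P] := Pb v (sb v (mem_head v s)).
  exists (maxn n n') => u; rewrite inE => /orP[/eqP ->|us].
    exact: Pm (leq_maxr _ _) n'P.
  exact: Pm (leq_maxl _ _) (nP _ us).
exists n => u ub.
have cl : submod_closed (fun u : R^o => (u \in b) && `[< P n u >]).
  split=> [|c v w /andP[vb /asboolP vP] /andP[wb /asboolP wP]].
    by apply/andP; split; [exact: rpred0|exact/asboolP].
  by apply/andP; split; [exact: idealD (idealMl _ _) _|apply/asboolP; exact: PD].
have : u \in Submodule cl.
  move: ub; rewrite sE; apply: span_min => v /= vs; apply/andP; split.
    by rewrite sE; exact: mem_span.
  exact/asboolP/nP.
by case/andP=> _ /asboolP.
Qed.

Lemma colon_closed b x N :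
  submod_closed (fun r : R^o => `[< exists n, x ^+ (N + n) * r \in b >]).
Proof.
split=> [|c u v]; first by apply/asboolP; exists 0%N; rewrite mulr0 ideal0.
move=> /asboolP[n hn] /asboolP[p hp]; apply/asboolP; exists (n + p)%N.
rewrite mulrDr idealD//.
  have -> : x ^+ (N + (n + p)) * (c * u) = (c * x ^+ p) * (x ^+ (N + n) * u).
    by rewrite addnA [X in X * _]exprD; ring.
  exact: idealMl.
rewrite addnCA [X in X * _]exprD -mulrA; exact: idealMl.
Qed.

(** The union of the ascending colon ideals [(b : x^n)] is an ideal, hence finitely generated. *)
Lemma colon_stable b x : exists N, forall n r, x ^+ n * r \in b -> x ^+ N * r \in b.
Proof.
have [||||N NP] := @noeth_bound (Submodule (colon_closed b x 0))
    (fun N r => x ^+ N * r \in b).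
- move=> n n' u nn un; rewrite -(subnK nn) exprD -mulrA; exact: idealMl.
- move=> n c u v _ _ un vn; by rewrite mulrDr idealD// mulrCA idealMl.
- by move=> n; rewrite mulr0 ideal0.
- by move=> u /asboolP.
by exists N => n r rn; apply: NP; apply/asboolP; exists n.
Qed.

(** The map [f] is a function on all of [R], constrained on [b] only; this avoids subtypes when a
    map is extended to a larger ideal. *)
Definition baer (E : lmodType R) (S : submodule E) :=
  forall (b : ideal R) (f : R -> E), (forall u, u \in b -> f u \in S) ->
    (forall c u v, u \in b -> v \in b -> f (c * u + v) = c *: f u + f v) ->
  exists2 e, e \in S & forall u, u \in b -> f u = u *: e.

Lemma injective_baer (E : lmodType R) (S : submodule E) : injective_module E ->
  (forall e, e \in S) -> baer S.
Proof.
move=> iE ES b f _ fl.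
have fl' : linear (fun u : submod b => f (val u)).
  by move=> c u v; apply: fl; exact: submod_valP.
have [g gE] := iE _ _ (val_lin b) (mklin fl') (@val_inj _ _ _).
exists (g 1) => // u ub; rewrite -linearZZ [_ *: _]mulr1.
exact: esym (gE (SubMod ub)).
Qed.

Lemma pow_torsion_closed (E : lmodType R) (S : submodule E) x :
  submod_closed (fun e => (e \in S) && `[< exists p, x ^+ p *: e = 0 >]).
Proof.
split=> [|c e e' /andP[eS /asboolP[p pe]] /andP[eS' /asboolP[p' pe']]].
  apply/andP; split; first exact: rpred0.
  by apply/asboolP; exists 0%N; rewrite scaler0.
apply/andP; split; first by rewrite rpredD ?rpredZ.
apply/asboolP; exists (p + p')%N.
rewrite scalerDr scalerA -[_ * c]mulrC -scalerA {1}addnC exprD exprD -!scalerA pe pe'.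
by rewrite !scaler0 addr0.
Qed.
Definition pow_torsion (E : lmodType R) (S : submodule E) x : submodule E :=
  Submodule (@pow_torsion_closed E S x).

Lemma pow_torsionP (E : lmodType R) (S : submodule E) x e :
  e \in pow_torsion S x <-> e \in S /\ exists p, x ^+ p *: e = 0.
Proof.
by split=> [/andP[eS /asboolP h]|[eS h]] //; apply/andP; split=> //; apply/asboolP.
Qed.

(* The submodule [pow_torsion S x] inherits Baer's criterion: a map on [b] whose
   values are killed by [x ^+ t] extends to [b + (x ^+ (N + t))] by [0], [N] being an
   index at which the colon ideals [(b : x ^+ N)] are stable. *)
Lemma baer_pow_torsion (E : lmodType R) (S : submodule E) x :
  baer S -> baer (pow_torsion S x).
Proof.
move=> bS b f fS fl.
have f0 : f 0 = 0.
  have := fl 1 0 0 (ideal0 b) (ideal0 b); rewrite mulr0 add0r scale1r => e.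
  by apply: (addrI (f 0)); rewrite addr0 -e.
have fZ c u : u \in b -> f (c * u) = c *: f u.
  by move=> ub; have := fl c u 0 ub (ideal0 b); rewrite !addr0 f0 addr0.
have [||||t tP] := @noeth_bound b (fun t u => x ^+ t *: f u = 0).
- by move=> n n' u nn un; rewrite -(subnK nn) exprD -scalerA un scaler0.
- move=> n c u v ub vb un vn; rewrite fl// scalerDr vn addr0.
  by rewrite scalerA mulrC -scalerA un scaler0.
- by move=> n; rewrite f0 scaler0.
- by move=> u /fS/pow_torsionP[].
have [N NP] := colon_stable b x.
pose n := (N + t)%N.
(* Two decompositions differ by [x ^+ n * (s - r)] in [b]; stability puts [x ^+ N * (s - r)] in [b]
   already, and [x ^+ t] kills its value under [f]. *)
have wd u v r s : u \in b -> v \in b -> u + x ^+ n * r = v + x ^+ n * s -> f u = f v.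
  move=> ub vb e; have uv : u - v = x ^+ n * (s - r).
    by rewrite -[u](addrK (x ^+ n * r)) e; ring.
  have : x ^+ N * (s - r) \in b.
    by apply: (NP n); rewrite -uv; exact: idealB.
  move=> /[dup] h /tP; rewrite -fZ// mulrA -exprD addnC -/n -uv => fuv.
  have := fl 1 (u - v) v (idealB ub vb) vb.
  by rewrite mul1r subrK scale1r fuv add0r.
pose dec w y := exists u r : R, [/\ u \in b, w = u + x ^+ n * r & y = f u].
have bc : submod_closed (fun w : R^o => `[< exists u r : R, u \in b /\ w = u + x ^+ n * r >]).
  split=> [|c w w' /asboolP[u [r [ub ->]]] /asboolP[v [s [vb ->]]]]; apply/asboolP.
    by exists 0, 0; split; [exact: ideal0|rewrite mulr0 addr0].
  exists (c * u + v), (c * r + s); split; first by rewrite idealD// idealMl.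
  by rewrite [_ *: _]mulrDr mulrDr mulrCA addrACA.
have decW w : exists y, (w \in Submodule bc -> dec w y) /\ (w \notin Submodule bc -> y = 0).
  have [/asboolP[u [r [ub wE]]]|wn] := boolP (w \in Submodule bc); last by exists 0.
  by exists (f u); split=> // _; exists u, r.
have [f' f'E] := choice decW.
have f'P u r : u \in b -> f' (u + x ^+ n * r) = f u.
  move=> ub; have [|v [s [vb e ->]]] := (f'E (u + x ^+ n * r)).1.
    by apply/asboolP; exists u, r.
  exact: wd vb ub (esym e).
have [|c w w' /asboolP[u [r [ub ->]]] /asboolP[v [s [vb ->]]]|e eS eP] :=
  bS (Submodule bc) f'.
- move=> w /asboolP[u [r [ub ->]]]; rewrite f'P//.
  by have /pow_torsionP[] := fS _ ub.
- have -> : c * (u + x ^+ n * r) + (v + x ^+ n * s) =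
      (c * u + v) + x ^+ n * (c * r + s) by ring.
  rewrite !f'P ?fl//; by apply: idealD => //; exact: idealMl.
exists e; last first.
  move=> u ub; rewrite -eP; last by apply/asboolP; exists u, 0; rewrite mulr0 addr0.
  by rewrite -[u in RHS]addr0 -(mulr0 (x ^+ n)) f'P.
(* The extension sends [x ^+ n] to 0, and its value there is [x ^+ n *: e]. *)
apply/pow_torsionP; split=> //; exists n; rewrite -eP.
  by have := f'P 0 1 (ideal0 b); rewrite add0r mulr1 f0.
by apply/asboolP; exists 0, 1; split; [exact: ideal0|rewrite add0r mulr1].
Qed.

(** Baer's criterion is applied to [x ^+ (N + k) * r -> (x ^+ N * r) *: m] on a principal ideal. The
    map is well defined because the annihilators of the powers of [x] are stable from [N] on, and
    its extension gives [e] with [x ^+ (N + k) *: e = x ^+ N *: m]. *)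
Lemma baer_divisible (E : lmodType R) (S : submodule E) x k m : baer S -> m \in S ->
  exists e s, e \in S /\ x ^+ s *: (x ^+ k *: e - m) = 0.
Proof.
move=> bS mS.
(* The zero ideal, whose colon ideals are the annihilators of the powers of [x]. *)
pose z : ideal R := ker (idl R^o).
have [N NP] := colon_stable z x.
pose l : {linear R^o -> R^o} := mklin (@scale_linear R R^o (x ^+ (N + k))).
have wd r r' : x ^+ (N + k) * r = x ^+ (N + k) * r' -> x ^+ N * r = x ^+ N * r'.
  move=> h; apply/eqP; rewrite -subr_eq0 -mulrBr; apply: (NP (N + k)%N).
  by change (x ^+ (N + k) * (r - r') == 0); rewrite mulrBr h subrr.
have decW w : exists y, w \in im l -> exists2 r, w = x ^+ (N + k) * r & y = (x ^+ N * r) *: m.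
  have [/imP[r rE]|] := boolP (w \in im l); last by exists 0.
  by exists ((x ^+ N * r) *: m) => _; exists r.
have [f fE] := choice decW.
have fP r : f (x ^+ (N + k) * r) = (x ^+ N * r) *: m.
  by have [|r' /wd -> ->] := fE (x ^+ (N + k) * r); first by apply/imP; exists r.
have [w /imP[r <-]|c _ _ /imP[r <-] /imP[r' <-]|e eS eP] := bS (im l) f.
- by rewrite /= fP rpredZ.
- rewrite /= -[c * _]mulrCA -mulrDr !fP scalerA -scalerDl.
  by congr (_ *: _); ring.
exists e, N; split=> //; rewrite scalerBr scalerA -exprD.
have := eP (x ^+ (N + k)); rewrite -[x ^+ (N + k)]mulr1 fP !mulr1 => -> //.
  by rewrite subrr.
by apply/imP; exists 1; exact: mulr1.
Qed.

(** Defined one element at a time so that Baer's criterion passes along the list; for the empty list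
    it is all of [E], as the kernel of the zero map. *)
Fixpoint list_torsion (E : lmodType R) (s : seq R) : submodule E :=
  if s is x :: s' then pow_torsion (list_torsion E s') x
  else ker (null_lin E E).

Lemma list_torsionP (E : lmodType R) (s : seq R) e :
  e \in list_torsion E s <-> forall x, x \in s -> exists p, x ^+ p *: e = 0.
Proof.
elim: s => [|x s IH] /=; first by split=> // _; exact: eqxx.
split=> [/pow_torsionP[/IH es ex] y|h].
  by rewrite inE => /orP[/eqP ->|/es].
apply/pow_torsionP; split; last by apply: h; exact: mem_head.
by apply/IH => y ys; apply: h; rewrite inE ys orbT.
Qed.

Lemma baer_list_torsion (E : lmodType R) (s : seq R) : injective_module E ->
  baer (list_torsion E s).
Proof.
move=> iE; elim: s => [|x s IH] /=; last exact: baer_pow_torsion.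
by apply: injective_baer => // e; exact: eqxx.
Qed.

End NoetherianTorsion.

(** * Torsion tested on generators of the ideal *)

Section TorsionGenerators.
Variables (R : comNzRingType) (a : ideal R) (s : seq R^o).
Hypothesis aE : a =i Defs.span [set` s].
Implicit Types (M : lmodType R) (x : R).

Lemma orbit_linear M (m : M) : linear (fun r : R^o => (r : R) *: m).
Proof. by move=> c u v; rewrite scalerDl -scalerA. Qed.

(** In a product of [n + 1] elements of [a], the last [n] kill [x *: m] for every generator [x], and
    the first is a combination of generators. *)
Lemma mem_torsion_gens M (m : M) : (forall x, x \in s -> x *: m \in torsion_submod a M) ->
  m \in torsion_submod a M.
Proof.
move=> h; have h' x : exists n, x \in s ->
    forall r, r \in ideal_exp a n -> (r : R) *: (x *: m) = 0.
  by have [/h/asboolP[n hn]|_] := boolP (x \in s); [exists n|exists 0%N].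
have [f fP] := choice h'.
pose n := (\sum_(x <- s) f x)%N.
have nP x r : x \in s -> r \in ideal_exp a n -> (r : R) *: (x *: m) = 0.
  move=> xs rn; apply: fP => //; apply: ideal_exp_sub rn.
  by rewrite /n (big_rem _ xs) leq_addr.
apply/asboolP; exists n.+1 => r rn; apply/eqP.
apply: (@span_min _ _ _ (ker (mklin (orbit_linear m)))) rn => _ /= [l [sl la ->]].
apply/eqP => /=; case: l sl la => //= u l [sl] la; rewrite big_cons mulrC.
set q := \prod_(x <- l) x.
have qn : q \in ideal_exp a n.
  by apply: mem_span; exists l; split=> // v vl; apply: la; rewrite inE vl orbT.
have : u \in a by apply: la; exact: mem_head.
rewrite aE => us; apply/eqP.
have ql : linear (fun r : R^o => (q * r) *: m).
  by move=> c v w; rewrite mulrDr scalerDl scalerA mulrCA.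
apply: (@span_min _ _ _ (ker (mklin ql))) us => v vs.
by apply/eqP; rewrite /= -scalerA nP.
Qed.

(** The converse is by induction on the sum of the exponents: multiplying [m] by a generator lowers
    the exponent of that generator by one. *)
Lemma torsion_gensP M (m : M) : m \in torsion_submod a M <->
  forall x, x \in s -> exists p, x ^+ p *: m = 0.
Proof.
split=> [/asboolP[n hn] x xs|h].
  exists n; apply: hn; apply: mem_span; exists (nseq n x).
  split; first exact: size_nseq.
    by move=> y /nseqP[-> _]; rewrite aE; exact: mem_span.
  by rewrite big_nseq -Monoid.iteropE.
have h' x : exists p, x \in s -> x ^+ p *: m = 0.
  by have [/h[p hp]|_] := boolP (x \in s); [exists p|exists 0%N].
have {h h'} [p pP] := choice h'.
have [N] := ubnP (\sum_(x <- s) p x)%N.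
elim: N m p pP => // N IH m p pP pN; apply: mem_torsion_gens => x xs.
case px : (p x) => [|k].
  by have := pP x xs; rewrite px expr0 scale1r => ->; rewrite scaler0 rpred0.
apply: (IH _ (fun y => if y == x then k else p y)) => [y ys|].
  case: eqP => [->|_].
    by rewrite scalerA -exprSr -px pP.
  by rewrite scalerA mulrC -scalerA pP// scaler0.
rewrite (big_rem _ xs) /= eqxx; rewrite (big_rem _ xs) /= px addSn ltnS in pN.
apply: leq_trans pN; rewrite ltnS leq_add2l; apply: leq_sum => y _.
by case: eqP => // ->; rewrite px.
Qed.

End TorsionGenerators.

(** * The Cech complex *)

Section CochainMaps.
Variable R : comNzRingType.
Implicit Types (A B C : cochain_complex R) (M N P : lmodType R).

Record cochain_map A B := CochainMap {
  cmap :> forall i, {linear A i -> B i};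
  cmapP : forall i x, coch_diff B i (cmap i x) = cmap i.+1 (coch_diff A i x) }.

Definition cochain_ses A B C (f : cochain_map A B) (g : cochain_map B C) :=
  forall i, ses (f i) (g i).

(** Exactness in positive degrees only; degree 0 cocycles are left free. *)
Definition acyclic C := forall i, exact_at (coch_diff C i) (coch_diff C i.+1).

Lemma prod_map_linear M N M' N' (f : {linear M -> M'}) (g : {linear N -> N'}) :
  linear (fun p : M * N => (f p.1, g p.2)).
Proof. by move=> c x y; rewrite !linearP. Qed.
Definition prod_map M N M' N' (f : {linear M -> M'}) (g : {linear N -> N'}) :
  {linear (M * N)%type -> (M' * N')%type} := mklin (prod_map_linear f g).

Lemma ses_prod M N P M' N' P' (f : {linear M -> N}) (g : {linear N -> P})
    (f' : {linear M' -> N'}) (g' : {linear N' -> P'}) :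
  ses f g -> ses f' g' -> ses (prod_map f f') (prod_map g g').
Proof.
move=> [fi ex gs] [fi' ex' gs']; split.
- by move=> [x x'] [y y'] /= [/fi -> /fi' ->].
- move=> [y y']; split=> [[/ex[x <-] /ex'[x' <-]]|[[x x'] [<- <-]]].
    by exists (x, x').
  by congr (_, _); [apply/ex; exists x|apply/ex'; exists x'].
by move=> [z z']; have [[y <-] [y' <-]] := (gs z, gs' z'); exists (y, y').
Qed.

Lemma ses_tensor P M N N' (f : {linear M -> N}) (g : {linear N -> N'}) :
  flat P -> ses f g -> ses (tensor_map P f) (tensor_map P g).
Proof.
by move=> fP [fi ex gs]; split; [exact: flat_injective|exact: fP|exact: tensor_map_surj].
Qed.

End CochainMaps.

Section LocCone.
Variables (R : comNzRingType) (x : R).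
Implicit Types (A B C G : cochain_complex R).

Definition cone_obj G i : lmodType R :=
  if i is j.+1 then (G j.+1 * loc x (G j))%type else G 0%N.

Definition cone_diff G i : {linear cone_obj G i -> cone_obj G i.+1} :=
  match i with
  | 0%N => pair_lin (coch_diff G 0) (to_loc x (G 0%N))
  | j.+1 => pair_lin (comp_lin (fst_lin (G j.+1) (loc x (G j))) (coch_diff G j.+1))
     (add_lin (comp_lin (fst_lin (G j.+1) (loc x (G j))) (to_loc x (G j.+1)))
       (opp_lin (comp_lin (snd_lin (G j.+1) (loc x (G j)))
         (tensor_map (locR x) (coch_diff G j)))))
  end.

Lemma cone_diff0E G (g : G 0%N) : cone_diff G 0 g = (coch_diff G 0 g, to_loc x _ g).
Proof. by []. Qed.

Lemma cone_diffSE G j (g : G j.+1) (h : loc x (G j)) :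
  cone_diff G j.+1 (g, h) = (coch_diff G j.+1 g,
    to_loc x _ g - tensor_map (locR x) (coch_diff G j) h).
Proof. by []. Qed.

Lemma loc_diffK G j (h : loc x (G j)) : tensor_map (locR x) (coch_diff G j.+1)
  (tensor_map (locR x) (coch_diff G j) h) = 0.
Proof.
rewrite (@tensor_map_comp _ _ _ _ _ _ _ (null_lin _ _)) ?tensor_map0// => z.
exact: coch_diffK.
Qed.

Lemma cone_diffK G i (g : cone_obj G i) : cone_diff G i.+1 (cone_diff G i g) = 0.
Proof.
case: i g => [|i]; last case; move=> g.
  rewrite cone_diff0E cone_diffSE coch_diffK; congr (_, _).
  by rewrite [X in _ - X]to_loc_map subrr.
move=> h; rewrite !cone_diffSE coch_diffK; congr (_, _).
have E : tensor_map (locR x) (coch_diff G i.+1)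
    (to_loc x _ g - tensor_map (locR x) (coch_diff G i) h) =
    to_loc x _ (coch_diff G i.+1 g).
  by rewrite linearB [X in _ - X]loc_diffK subr0; exact: to_loc_map.
by rewrite [X in _ - X]E subrr.
Qed.

(* The shifted mapping cone of [G -> G_x]. *)
Definition loc_cone G : cochain_complex R := CochainComplex (@cone_diffK G).

Definition cone_map_comp A B (f : cochain_map A B) i :
    {linear cone_obj A i -> cone_obj B i} :=
  match i with
  | 0%N => f 0%N
  | j.+1 => prod_map (f j.+1) (tensor_map (locR x) (f j))
  end.

Lemma cone_mapP A B (f : cochain_map A B) i g :
  cone_diff B i (cone_map_comp f i g) = cone_map_comp f i.+1 (cone_diff A i g).
Proof.
case: i g => [|i] g.
  rewrite cone_diff0E /= cmapP; congr (_, _).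
  exact: esym (to_loc_map x _ g).
case: g => g h; change ((coch_diff B i.+1 (f i.+1 g), to_loc x _ (f i.+1 g) -
    tensor_map (locR x) (coch_diff B i) (tensor_map (locR x) (f i) h)) =
  (f i.+2 (coch_diff A i.+1 g), tensor_map (locR x) (f i.+1)
    (to_loc x _ g - tensor_map (locR x) (coch_diff A i) h))).
rewrite cmapP linearB; congr (_, _ - _); first exact: esym (to_loc_map x _ g).
rewrite (tensor_map_comp (h := comp_lin (f i) (coch_diff B i)))//.
rewrite [RHS](tensor_map_comp (h := comp_lin (f i) (coch_diff B i)))// => z.
by rewrite comp_linE cmapP.
Qed.

Definition cone_map A B (f : cochain_map A B) : cochain_map (loc_cone A) (loc_cone B) :=
  @CochainMap R (loc_cone A) (loc_cone B) (cone_map_comp f) (cone_mapP f).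

Lemma cone_ses A B C (f : cochain_map A B) (g : cochain_map B C) :
  cochain_ses f g -> cochain_ses (cone_map f) (cone_map g).
Proof.
move=> fg [|i]; first exact: fg.
by apply: ses_prod => //; apply: ses_tensor => //; exact: flat_locR.
Qed.

(** In a cocycle [(g, h)], [g] bounds some [g1], and [h - g1 / 1] is a cocycle of the localized
    complex. By flatness it is a coboundary, except when it has degree 0; the second hypothesis then
    says that degree 0 cocycles map onto their localization. *)
Lemma cone_acyclic G : acyclic G ->
  (forall k (m : G 0%N), coch_diff G 0 m = 0 ->
    exists e s, coch_diff G 0 e = 0 /\ x ^+ s *: (x ^+ k *: e - m) = 0) ->
  acyclic (loc_cone G).
Proof.
move=> exG div [|i] [g h]; (split=> [|[z <-]]; last exact: cone_diffK).
all: rewrite [X in X -> _]/= => -[/exG[g1 <-] /eqP]; rewrite subr_eq0 => /eqP e.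
all: have {}e : tensor_map (locR x) (coch_diff G _) (h - to_loc x _ g1) = 0
  by rewrite linearB [X in _ - X]to_loc_map -[X in X - _]e subrr.
  have [k k0 kE] : exists2 k, coch_diff G 0 k = 0 & to_loc x _ k = h - to_loc x _ g1.
    have exK : exact_at (val_lin (ker (coch_diff G 0))) (coch_diff G 0).
      move=> y; split=> [y0|[[y' yk] <-]]; last exact/eqP.
      by have yk : y \in ker (coch_diff G 0) by [rewrite mem_ker y0]; exists (SubMod yk).
    have /(@flat_locR R x _ _ _ _ _ exK)[u uE] := e.
    have [|k kE] := @to_loc_surj R x (submod (ker (coch_diff G 0))) _ u.
      move=> n [m mK]; have [|e' [s [e'0 se]]] := div n m; first exact/eqP.
      have eK : e' \in ker (coch_diff G 0) by rewrite mem_ker e'0.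
      by exists (SubMod eK), s; apply: val_inj.
    exists (val k); first by case: k {kE} => k kK; exact/eqP.
    rewrite -uE -[in RHS]kE; exact: esym (to_loc_map _ _ _).
  exists (g1 + k); apply: etrans (cone_diff0E _) _.
  by rewrite !linearD kE k0 addr0 addrC subrK.
have /(@flat_locR R x _ _ _ _ _ (exG i))[u uE] := e.
exists (g1, - u); apply: etrans (cone_diffSE _ _) _.
by rewrite linearN opprK [X in _ + X]uE addrC subrK.
Qed.

End LocCone.

Section Cech.
Variable R : comNzRingType.
Implicit Types (M N P E : lmodType R) (s : seq R).

Definition deg0_obj M i : lmodType R := if i is 0%N then M else zmod0 R.

Lemma deg0_diffK M i (m : deg0_obj M i) :
  null_lin (deg0_obj M i.+1) (deg0_obj M i.+2) (null_lin _ _ m) = 0.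
Proof. by []. Qed.
Definition deg0_complex M : cochain_complex R :=
  CochainComplex (@deg0_diffK M).

Definition deg0_map_comp M N (f : {linear M -> N}) i :
    {linear deg0_obj M i -> deg0_obj N i} :=
  if i is 0%N then f else null_lin _ _.

Lemma deg0_mapP M N (f : {linear M -> N}) i x :
  coch_diff (deg0_complex N) i (deg0_map_comp f i x) =
  deg0_map_comp f i.+1 (coch_diff (deg0_complex M) i x).
Proof. by []. Qed.
Definition deg0_map M N (f : {linear M -> N}) :
  cochain_map (deg0_complex M) (deg0_complex N) :=
  @CochainMap R (deg0_complex M) (deg0_complex N) (deg0_map_comp f) (deg0_mapP f).

Fixpoint cech s M : cochain_complex R :=
  if s is x :: s' then loc_cone x (cech s' M) else deg0_complex M.

Fixpoint cech_map s M N (f : {linear M -> N}) : cochain_map (cech s M) (cech s N) :=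
  match s with
  | [::] => deg0_map f
  | x :: s' => cone_map x (cech_map s' f)
  end.

(** The degree 0 term reduces to [M] only once [s] is known, so the identification is given as a
    map. *)
Fixpoint cech_aug s M : {linear M -> cech s M 0%N} :=
  match s with
  | [::] => idl M
  | x :: s' => cech_aug s' M
  end.

Lemma cech0 s M : cech s M 0%N = M.
Proof. by elim: s. Qed.

Lemma cech_aug_inj s M : injective (cech_aug s M).
Proof. by elim: s. Qed.

Lemma cech_aug_surj s M y : exists x, cech_aug s M x = y.
Proof. by elim: s y => //= y; exists y. Qed.

Lemma cech_aug_map s M N (f : {linear M -> N}) x :
  cech_map s f 0 (cech_aug s M x) = cech_aug s N (f x).
Proof. by elim: s. Qed.

Lemma cech_ses s M N P (f : {linear M -> N}) (g : {linear N -> P}) : ses f g ->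
  cochain_ses (cech_map s f) (cech_map s g).
Proof.
move=> fg; elim: s => [|x s IH] /=; last exact: cone_ses.
case=> [|i] //=; split=> [y z _|y|z].
- by rewrite (zmod0_zero y) (zmod0_zero z).
- by split=> // _; exists 0; rewrite (zmod0_zero y).
by exists 0; rewrite (zmod0_zero z).
Qed.

Lemma zero_module_prod M N : zero_module M -> zero_module N -> zero_module (M * N)%type.
Proof. by move=> M0 N0 [m n]; rewrite (M0 m) (N0 n). Qed.

Lemma cech_bound s M i : (size s < i)%N -> zero_module (cech s M i).
Proof.
elim: s i => [|x s IH] [|i] //=; first by move=> _; exact: zmod0_zero.
rewrite ltnS => si; apply: zero_module_prod; first by apply: IH; exact: ltnW.
exact/tensor_zeror/IH.
Qed.

Lemma cech_zero s M i : zero_module M -> zero_module (cech s M i).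
Proof.
move=> M0; elim: s i => [|x s IH] [|i] //=; first exact: zmod0_zero.
by apply: zero_module_prod; [exact: IH|exact/tensor_zeror/IH].
Qed.

Lemma cech_tor_van s M j N i : tor_van j.+1 N M -> tor_van j.+1 N (cech s M i).
Proof.
move=> vM; elim: s i => [|x s IH] [|i] //.
- exact/zero_tor_van/zmod0_zero.
- exact: IH 0%N.
apply: (@tor_van_prod _ _ _ (cech s M i.+1) (loc x (cech s M i))); first exact: IH.
by apply: tor_van_tensor; [exact: flat_locR|exact: IH].
Qed.

Lemma cech_tor_van_killed s M j N i : (forall x, x \in s -> forall n : N, x *: n = 0) ->
  tor_van j N (cech s M i.+1).
Proof.
elim: s i => [|x s IH] i h /=; first exact/zero_tor_van/zmod0_zero.
apply: (@tor_van_prod _ _ _ (cech s M i.+1) (loc x (cech s M i))).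
  by apply: IH => y ys; apply: h; rewrite inE ys orbT.
by apply: tor_van_loc; exact/h/mem_head.
Qed.

Lemma cech_cocycle0 s M m :
  coch_diff (cech s M) 0 (cech_aug s M m) = 0 <->
  forall x, x \in s -> exists p, x ^+ p *: m = 0.
Proof.
elim: s => [|x s IH]; first by split.
have E : cech_aug (x :: s) M m = cech_aug s M m by [].
split=> [h y|h].
  have h1 := congr1 fst h; have h2 := congr1 snd h.
  rewrite inE => /orP[/eqP ->|ys]; last exact: IH.1.
  have /to_loc_eq0[p pe] := h2; exists p; apply: (@cech_aug_inj s).
  by rewrite linearZZ linear0 -pe.
apply: etrans (cone_diff0E _ _) _; congr (_, _).
  by apply/IH => y ys; apply: h; rewrite inE ys orbT.
apply/to_loc_eq0; have [p pe] := h x (mem_head _ _); exists p.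
by rewrite -linearZZ pe linear0.
Qed.

(** The degree 0 cocycles are the list torsion of [E]; Baer's criterion for it gives the
    divisibility that the next cone requires. *)
Lemma cech_acyclic s E : noetherian R -> injective_module E -> acyclic (cech s E).
Proof.
move=> noethR iE; elim: s => [|x s IH].
  move=> i y; split=> _; last exact: zmod0_zero.
  by exists 0; rewrite linear0 (zmod0_zero y).
apply: cone_acyclic => // k m m0.
have [e eE] := cech_aug_surj m; rewrite -eE in m0.
have /(baer_divisible noethR x k (@baer_list_torsion _ noethR E s iE)) :
    e \in list_torsion E s by apply/list_torsionP/cech_cocycle0.
move=> [e' [t [/list_torsionP/cech_cocycle0 e'0 te]]].
exists (cech_aug s E e'), t; split=> //.
by rewrite -eE -!linearZZ -linearB -linearZZ te linear0.
Qed.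

End Cech.

(** * Local cohomology as Cech cohomology *)

Section Similarity.
Variable R : comNzRingType.
Implicit Types B : lmodType R.

Definition lin_closed B (Z : B -> Prop) :=
  forall c x y, Z x -> Z y -> Z (c *: x + y).

(* An isomorphism between the subquotients [Z / D] and [Z' / D'], given as a linear
   relation between representatives. *)
Definition sim B B' (Z D : B -> Prop) (Z' D' : B' -> Prop) :=
  exists r : B -> B' -> Prop,
  [/\ forall c x y x' y', r x x' -> r y y' -> r (c *: x + y) (c *: x' + y'),
      forall z, Z z -> exists2 z', Z' z' & r z z',
      forall z', Z' z' -> exists2 z, Z z & r z z' &
      forall z z', Z z -> Z' z' -> r z z' -> (D z <-> D' z')].

Lemma sim_trans B1 B2 B3 (Z1 D1 : B1 -> Prop) (Z2 D2 : B2 -> Prop)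
    (Z3 D3 : B3 -> Prop) : lin_closed Z2 ->
  sim Z1 D1 Z2 D2 -> sim Z2 D2 Z3 D3 -> sim Z1 D1 Z3 D3.
Proof.
move=> Zl [r [rl r1 r2 rD]] [t [tl t1 t2 tD]].
exists (fun x z => exists y, [/\ Z2 y, r x y & t y z]); split.
- move=> c x y x' y' [u [Zu xu ux']] [v [Zv yv vy']].
  by exists (c *: u + v); split; [exact: Zl|exact: rl|exact: tl].
- by move=> x /r1[y Zy xy]; have [z Zz yz] := t1 y Zy; exists z => //; exists y.
- by move=> z /t2[y Zy yz]; have [x Zx xy] := r2 y Zy; exists x => //; exists y.
by move=> x z Zx Zz [y [Zy xy yz]]; rewrite (rD x y)// (tD y z).
Qed.

End Similarity.

Section TorsionCech.
Variables (R : comNzRingType) (a : ideal R) (s : seq R).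
Hypotheses (noethR : noetherian R) (aE : a =i Defs.span [set` (s : seq R^o)]).
Implicit Types (M N E : lmodType R) (C : cochain_complex R).

Definition cocycle C i (z : C i) := coch_diff C i z = 0.

Lemma cocycle_lin C i : lin_closed (@cocycle C i).
Proof. by move=> c x y; rewrite /cocycle linearP => -> ->; rewrite scaler0 addr0. Qed.

(** Torsion cocycles are described by their representatives in [C i], outside the nested subtypes of
    the torsion complex. *)
Definition torsion_cocycle C i (z : C i) := z \in torsion_submod a (C i) /\ cocycle z.

Definition torsion_coboundary C i : C i -> Prop :=
  match i return C i -> Prop with
  | 0%N => fun z => z = 0
  | j.+1 => fun z => exists2 y, y \in torsion_submod a (C j) & coch_diff C j y = z
  end.

Definition shift_complex C : cochain_complex R :=
  @CochainComplex R (fun i => C i.+1) (fun i => coch_diff C i.+1)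
    (fun i => @coch_diffK R C i.+1).

Section Shift.
Variables (M : lmodType R) (I : injective_resolution M).

(** The first cosyzygy, taken as the kernel in degree 1 so that the shifted complex resolves it with
    the inclusion as augmentation. *)
Definition cosyz : lmodType R := submod (ker (coch_diff I 1)).

Lemma cosyz_exact : exact_at (val_lin (ker (coch_diff I 1))) (coch_diff I 1).
Proof.
move=> y; split=> [y0|[[x xk] <-]]; last exact/eqP.
have yk : y \in ker (coch_diff I 1) by rewrite mem_ker y0.
by exists (SubMod yk).
Qed.

Definition shift_resolution : injective_resolution cosyz :=
  @InjectiveResolution R cosyz (shift_complex I) (val_lin (ker (coch_diff I 1)))
   (fun i => @ires_injective _ _ I i.+1) (@val_inj _ _ _) cosyz_exact
   (fun i => @ires_exact _ _ I i.+1).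

Lemma diff0_cosyz x : coch_diff I 0 x \in ker (coch_diff I 1).
Proof. by rewrite mem_ker coch_diffK. Qed.
Definition to_cosyz : {linear I 0%N -> cosyz} := corestrict_lin diff0_cosyz.

Lemma cosyz_ses : ses (ires_aug I) to_cosyz.
Proof.
split; first exact: ires_aug_inj.
  move=> y; rewrite -(@ires_exact0 _ _ I y); split=> [/(congr1 val)//|y0].
  exact: val_inj.
move=> [z zk]; have /(@ires_exact _ _ I 0)[y yE] : coch_diff I 1 z = 0 by exact/eqP.
by exists y; apply: val_inj.
Qed.

(** Both sides are the torsion of [M]. The divisors are kept general: they are zero in degree 0, and
    images of torsion when the lemma serves degree 1 through the shifted resolution. *)
Lemma sim_degree0 (D : I 0%N -> Prop) (D' : cech s M 0%N -> Prop) :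
  (forall m, D (ires_aug I m) <-> D' (cech_aug s M m)) ->
  sim (@torsion_cocycle I 0) D (@cocycle (cech s M) 0) D'.
Proof.
move=> DD'; exists (fun z w => exists2 m, z = ires_aug I m & w = cech_aug s M m).
have tE m : ires_aug I m \in torsion_submod a (I 0%N) <-> cocycle (cech_aug s M m).
  rewrite /cocycle cech_cocycle0 (torsion_gensP aE).
  by split=> h x /h[p hp]; exists p;
    [apply: (inj0 (@ires_aug_inj _ _ I)); rewrite linearZZ|rewrite -linearZZ hp linear0].
split.
- move=> c x y x' y' [m -> ->] [m' -> ->].
  by exists (c *: m + m'); rewrite linearP.
- move=> z [zt /(@ires_exact0 _ _ I)[m mE]]; exists (cech_aug s M m); last by exists m.
  by apply/tE; rewrite mE.
- move=> w w0; have [m mE] := cech_aug_surj w; exists (ires_aug I m); last by exists m.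
  split; first by apply/tE; rewrite mE.
  by apply/(@ires_exact0 _ _ I); exists m.
by move=> _ _ _ _ [m -> ->].
Qed.

End Shift.

(** The relation is the connecting map: [z] is lifted to [y], whose differential comes from [M].
    Acyclicity for [E] makes [H^(i+1)(M)] the quotient of [H^i(N)] by the image of [H^i(E)], which
    may be nonzero for [i = 0]. *)
Lemma sim_connecting M E N (f : {linear M -> E}) (g : {linear E -> N}) i :
  ses f g -> acyclic (cech s E) ->
  sim (@cocycle (cech s N) i)
    (fun z => exists2 y, cocycle y & cech_map s g i y = z)
    (@cocycle (cech s M) i.+1) (@is_coboundary R (cech s M) i.+1).
Proof.
move=> fg acE; have sesC := cech_ses s fg.
have gf0 j x : cech_map s g j (cech_map s f j x) = 0.
  by have [_ ex _] := sesC j; apply/ex; exists x.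
exists (fun z w => exists2 y, cech_map s g i y = z &
  coch_diff _ i y = cech_map s f i.+1 w); split.
- move=> c x y x' y' [u <- ux'] [v <- vy']; exists (c *: u + v); first by rewrite linearP.
  by rewrite !linearP ux' vy'.
- move=> z z0; have [_ _ gs] := sesC i; have [y yE] := gs z.
  have [_ ex _] := sesC i.+1; have /ex[w wE] : cech_map s g i.+1 (coch_diff _ i y) = 0.
    by rewrite -cmapP yE.
  exists w; last by exists y.
  have [fi _ _] := sesC i.+2; apply: (inj0 fi).
  by rewrite -cmapP wE coch_diffK.
- move=> w w0; have /acE[y yE] : coch_diff _ i.+1 (cech_map s f i.+1 w) = 0.
    by rewrite cmapP w0 linear0.
  exists (cech_map s g i y); last by exists y.
  by rewrite /cocycle cmapP yE gf0.
move=> z w z0 w0 [y yz yw]; split=> [[y1 y10 y1z]|[v vw]].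
  have [_ ex _] := sesC i; have /ex[v vE] : cech_map s g i (y - y1) = 0.
    by rewrite linearB yz y1z subrr.
  exists v; have [fi _ _] := sesC i.+1; apply: fi.
  by rewrite -cmapP vE linearB y10 subr0.
exists (y - cech_map s f i v); last by rewrite linearB gf0 subr0.
by rewrite /cocycle linearB cmapP yw vw subrr.
Qed.

Lemma sim_torsion_cech i M (I : injective_resolution M) :
  sim (@torsion_cocycle I i) (@torsion_coboundary I i)
    (@cocycle (cech s M) i) (@is_coboundary R (cech s M) i).
Proof.
elim: i M I => [|i IH] M I.
  apply: sim_degree0 => m; split=> /= m0.
    by rewrite (inj0 (@ires_aug_inj _ _ I) m0) linear0.
  by rewrite (inj0 (@cech_aug_inj R s M) m0) linear0.
have acE := cech_acyclic (s := s) noethR (@ires_injective _ _ I 0).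
have conn := sim_connecting i (cosyz_ses I) acE.
apply: sim_trans conn; first exact: cocycle_lin.
(* In degree 1 the divisor is the image of the torsion of [I 0]; above, the induction hypothesis is
   used for the shifted resolution. *)
case: i IH => [|i] IH.
  apply: (@sim_degree0 _ (shift_resolution I)) => m; split=> [[y yt ym]|[y y0 ym]].
    exists (cech_aug s _ y); first exact/cech_cocycle0/(torsion_gensP aE).
    by rewrite cech_aug_map; congr (cech_aug _ _ _); exact: val_inj.
  have [e eE] := cech_aug_surj y; rewrite -eE in y0 ym.
  exists e; first exact/(torsion_gensP aE)/cech_cocycle0.
  by move: ym; rewrite cech_aug_map => /cech_aug_inj <-.
have := IH _ (shift_resolution I).
(* In positive degree the Cech cocycles of [I 0] are coboundaries, so their images are exactly the
   coboundaries. *)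
have h z : @cocycle (cech s (cosyz I)) i.+1 z -> (is_coboundary z <->
  exists2 y, @cocycle (cech s (I 0%N)) i.+1 y & cech_map s (to_cosyz I) i.+1 y = z).
  have [_ _ gs] := cech_ses s (cosyz_ses I) i.
  move=> _; split=> [[w <-]|[y /acE[u <-] <-]].
    have [y <-] := gs w; exists (coch_diff _ i y); first exact: coch_diffK.
    by rewrite cmapP.
  by exists (cech_map s (to_cosyz I) i u); rewrite cmapP.
move=> [r [rl r1 r2 rD]]; exists r; split=> // z z' Zz Zz' zz'.
by rewrite -h//; exact: rD.
Qed.

(** A surjection with known kernel is the form that enters a short exact sequence with cocycles and
    boundaries. *)
Lemma cech_local_cohomology n M (I : injective_resolution M) :
  exists2 p : {linear submod (cocycles (cech s M) n) -> local_cohomology a I n},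
    forall h, exists z, p z = h &
    forall z, p z = 0 <-> is_coboundary (val z).
Proof.
have [r [rl r1 r2 rD]] := sim_torsion_cech n I.
pose T := torsion_complex a I.
pose q : {linear submod (cocycles T n) -> local_cohomology a I n} :=
  quot_pi (coboundaries T n).
have tc (z : T n) : coch_diff T n z = 0 -> torsion_cocycle (val z).
  by move=> z0; split; [exact: submod_valP|exact: (congr1 val z0)].
have tb (z : T n) : is_coboundary z <-> torsion_coboundary (val z).
  rewrite /torsion_coboundary; case: (n) z => [|j] z.
    by split=> [->//|z0]; exact: val_inj.
  split=> [[y <-]|[y yt yz]].
    by exists (val y) => //; exact: submod_valP.
  by exists (SubMod yt); exact: val_inj.
have ex (w : submod (cocycles (cech s M) n)) :
    exists z : submod (cocycles T n), r (val (val z)) (val w).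
  have w0 : cocycle (val w) by apply/eqP; exact: (submod_valP w).
  have [z [zt z0] zw] := r2 _ w0.
  have zk : SubMod zt \in cocycles T n by apply/eqP; exact: val_inj.
  by exists (SubMod zk).
have qP (z : submod (cocycles T n)) (w : submod (cocycles (cech s M) n)) :
    r (val (val z)) (val w) -> q z = 0 <-> @is_coboundary R (cech s M) n (val w).
  move=> zw; rewrite quot_pi0.
  have -> : z \in coboundaries T n <-> @is_coboundary R T n (val z).
    by split=> [/asboolP|h] //; apply/asboolP.
  rewrite tb; apply: rD => //; first by apply: tc; apply/eqP; exact: (submod_valP z).
  by apply/eqP; exact: (submod_valP w).
have [f fP] := choice ex.
have cob0 : @is_coboundary R (cech s M) n 0.
  by case: (n) => //= j; exists 0; rewrite linear0.
(* Torsion cocycles related to the same Cech cocycle differ by one related to 0, hence by a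
   coboundary; so the arbitrary choice [f] becomes linear after [q]. *)
have fl : linear (fun w => q (f w)).
  move=> c u v; apply/eqP; rewrite -subr_eq0 -linearP -linearB; apply/eqP.
  apply/(qP _ 0) => //.
  have := rl (-1) _ _ _ _ (rl c _ _ _ _ (fP u) (fP v)) (fP (c *: u + v)).
  by rewrite /= !scaleN1r ![- _ + _]addrC subrr.
exists (mklin fl) => [h|w]; last exact: qP.
have [z <-] := quot_pi_surj h.
have [w w0 zw] := r1 _ (tc _ (eqP (submod_valP z))).
have wk : w \in cocycles (cech s M) n by exact/eqP.
exists (SubMod wk); apply/eqP; rewrite -subr_eq0 /= -linearB; apply/eqP.
apply/(qP _ 0) => //.
have := rl (-1) _ _ _ _ zw (fP (SubMod wk)).
by rewrite /= !scaleN1r ![- _ + _]addrC subrr.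
Qed.

End TorsionCech.

(** * Finitely generated modules over a local ring *)

Section FiniteGeneration.
Variable R : comNzRingType.
Implicit Types (M : lmodType R).

Definition fgen M n := exists g : 'I_n -> M, forall x, exists z, free_lift g z = x.

Lemma free_lift_onto M (K : choiceType) (g : K -> M) (l : seq M) x :
  (forall y, y \in l -> exists z, free_lift g z = y) ->
  x \in Defs.span [set` l] -> exists z, free_lift g z = x.
Proof.
move=> h xl; apply/(imP (free_lift g)); move: x xl.
by apply: span_min => y /h yg; apply/imP.
Qed.

Lemma fgen_span M (S : submodule M) (l : seq M) : (forall x, x \in l -> x \in S) ->
  (forall x, x \in S -> x \in Defs.span [set` l]) -> fgen (submod S) (size l).
Proof.
move=> lS Sl; have gS (i : 'I_(size l)) : nth 0 l i \in S by apply/lS/mem_nth.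
exists (fun i => SubMod (gS i)) => x.
pose h := comp_lin (free_lift (fun i => SubMod (gS i))) (val_lin S).
have : submod_val x \in im h.
  move: (submod_val x) (Sl _ (submod_valP x)); apply: span_min => y yl.
  have il : (index y l < size l)%N by rewrite index_mem.
  apply/imP; exists << Ordinal il >>.
  by rewrite /h /= free_liftE /= nth_index.
by move=> /imP[z zE]; exists z; exact: val_inj.
Qed.

Lemma fg_fgen M : finitely_generated M -> exists n, fgen M n.
Proof.
move=> [l lM]; exists (size l), (fun i : 'I_(size l) => nth 0 l i) => x.
apply: (free_lift_onto _ (lM x)) => y yl.
have il : (index y l < size l)%N by rewrite index_mem.
by exists << Ordinal il >>; rewrite free_liftE /= nth_index.
Qed.

Lemma freeg_fg n : finitely_generated {freeg 'I_n / R}.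
Proof.
exists [seq << i >> | i <- enum 'I_n].
apply: freeg_lin_ind => [|c u v uS vS|i]; first exact: rpred0.
  by rewrite rpredD// rpredZ.
by apply: mem_span; apply: map_f; rewrite mem_enum.
Qed.

Lemma cons_span M (g : M) l x : x \in Defs.span [set` g :: l] ->
  exists r y, y \in Defs.span [set` l] /\ x = r *: g + y.
Proof.
have cl : submod_closed (fun x =>
    `[< exists r y, y \in Defs.span [set` l] /\ x = r *: g + y >]).
  split=> [|c u v /asboolP[r [y [yl ->]]] /asboolP[t [z [zl ->]]]]; apply/asboolP.
    by exists 0, 0; rewrite scale0r addr0; split=> //; exact: rpred0.
  exists (c * r + t), (c *: y + z); split; first by rewrite rpredD ?rpredZ.
  by rewrite scalerDl scalerDr scalerA addrACA.
move=> xl; apply/asboolP; move: x xl; apply: (span_min (S := Submodule cl)) => y /=.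
rewrite inE => /orP[/eqP ->|yl]; apply/asboolP.
  by exists 1, 0; rewrite scale1r addr0; split=> //; exact: (rpred0 (Defs.span [set` l])).
by exists 0, y; rewrite scale0r add0r; split=> //; exact: mem_span.
Qed.

(** Induction on the generators: the coefficients of [g] in elements of [S] form a finitely
    generated ideal. Lifts of its generators, with generators of the part of [S] in the span of [l],
    generate [S]. *)
Lemma noeth_submodule M (l : seq M) (S : submodule M) : noetherian R ->
  (forall x, x \in S -> x \in Defs.span [set` l]) ->
  exists l' : seq M, (forall x, x \in l' -> x \in S) /\
    forall x, x \in S -> x \in Defs.span [set` l'].
Proof.
move=> noethR; elim: l S => [|g l IH] S Sl; first by exists [::].
pose J0 : {pred R^o} := fun r : R^o =>
  `[< exists2 y, y \in Defs.span [set` l] & (r : R) *: g + y \in S >].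
have Jc : submod_closed J0.
  split=> [|c u v /asboolP[y yl yS] /asboolP[z zl zS]]; apply/asboolP.
    by exists 0; rewrite ?scale0r ?addr0; exact: rpred0.
  exists (c *: y + z); first by rewrite rpredD ?rpredZ.
  by rewrite scalerDl -scalerA addrACA -scalerDr rpredD ?rpredZ.
have [rs rsE] := noethR (Submodule Jc).
have h r : exists y, r \in rs -> y \in Defs.span [set` l] /\ (r : R) *: g + y \in S.
  have [rr|_] := boolP (r \in rs); last by exists 0.
  have : r \in Submodule Jc by rewrite rsE; exact: mem_span.
  by move=> /asboolP[y yl yS]; exists y.
have [f fP] := choice h.
pose S'0 : {pred M} := fun y => (y \in S) && (y \in Defs.span [set` l]).
have Sc : submod_closed S'0.
  split=> [|c u v /andP[uS ul] /andP[vS vl]]; apply/andP; first by split; exact: rpred0.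
  by rewrite !rpredD ?rpredZ.
have [|l' [l'S l'P]] := IH (Submodule Sc); first by move=> x /andP[].
pose xs := [seq (r : R) *: g + f r | r <- rs].
exists (xs ++ l'); split=> [x|x xS].
  by rewrite mem_cat => /orP[/mapP[r /fP[_ rS] ->]|/l'S/andP[]].
have sub1 y : y \in Defs.span [set` xs] -> y \in Defs.span [set` xs ++ l'] /\ y \in S.
  move=> yx; split; move: y yx; apply: span_min => y /= yx.
    by apply: mem_span; rewrite /= mem_cat yx.
  by case/mapP: yx => r /fP[_ rS] ->.
have sub2 y : y \in Defs.span [set` l'] -> y \in Defs.span [set` xs ++ l'].
  by apply: span_min => z zl; apply: mem_span; rewrite /= mem_cat [z \in l']zl orbT.
have [r [y [yl xE]]] := cons_span (Sl _ xS).
have rJ : r \in Submodule Jc by apply/asboolP; exists y; rewrite -?xE.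
(* The coefficients of [g] attained by the span of [xs]; they include [rs], hence [r], so the [g]
   term of [x] can be removed. *)
pose J1 : {pred R^o} := fun r : R^o =>
  `[< exists2 y, y \in Defs.span [set` l] & (r : R) *: g + y \in Defs.span [set` xs] >].
have J1c : submod_closed J1.
  split=> [|c u v /asboolP[y' yl' yS'] /asboolP[z' zl' zS']]; apply/asboolP.
    by exists 0; rewrite ?scale0r ?addr0; exact: rpred0.
  exists (c *: y' + z'); first by rewrite rpredD ?rpredZ.
  by rewrite scalerDl -scalerA addrACA -scalerDr rpredD ?rpredZ.
have /asboolP[y' yl' y'S] : r \in Submodule J1c.
  rewrite rsE in rJ; apply: (@span_min R R^o [set` rs] (Submodule J1c)) rJ => t rt.
  have [fl fS] := fP _ rt.
  by apply/asboolP; exists (f t) => //; apply: mem_span; exact: map_f.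
have [yx yS] := sub1 _ y'S.
have -> : x = (r *: g + y') + (x - (r *: g + y')) by rewrite addrC subrK.
rewrite rpredD//; apply/sub2/l'P/andP; split; first exact: rpredB.
by rewrite xE opprD addrACA subrr add0r rpredB.
Qed.

Lemma fgen_submodule M (S : submodule M) : noetherian R -> finitely_generated M ->
  exists n, fgen (submod S) n.
Proof.
move=> noethR [l lM]; have [|l' [l1 l2]] := @noeth_submodule M l S noethR.
  by move=> x _; exact: lM.
by exists (size l'); exact: fgen_span l1 l2.
Qed.

End FiniteGeneration.

(** * Minimal generators, the residue field and Nakayama's lemma *)

Section LocalFiniteGeneration.
Variables (R : comNzRingType) (m : ideal R).
Hypotheses (noethR : noetherian R) (maxm : maximal_ideal m)
  (mu : forall m', maximal_ideal m' -> m' =i m).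
Implicit Types (M : lmodType R).

Definition residue : lmodType R := quotmod m.

Lemma residue_killed (x : R) : x \in m -> forall c : residue, x *: c = 0.
Proof.
move=> xm c; have [y <-] := quot_pi_surj c.
have := @idealMl R m y x xm; rewrite mulrC => xy.
apply: etrans (esym (linearZZ (quot_pi m) x y)) _; exact/quot_pi0.
Qed.

(** A relation with a coefficient outside [m] expresses one generator through the others, since that
    coefficient is a unit. *)
Lemma minimal_gens M n : fgen M n -> (forall p, fgen M p -> (n <= p)%N) ->
  exists g : 'I_n -> M, (forall x, exists z, free_lift g z = x) /\
    forall z, free_lift g z = 0 -> forall i, coeff i z \in m.
Proof.
move=> [g gs] nmin; exists g; split=> // z z0 i; apply: contrapT => /negP zi.
have [v vz] := local_unit mu zi.
case: n i g gs nmin z z0 zi vz => [[]//|n] i g gs nmin z z0 zi vz.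
suff /nmin : fgen M n by rewrite ltnn.
pose g' j := g (fintype.lift i j); exists g'.
have gl j : g (fintype.lift i j) \in im (free_lift g').
  by apply/imP; exists << j >>; exact: free_liftE.
have gi : g i \in im (free_lift g').
  have : v *: free_lift g z = 0 by rewrite z0 scaler0.
  rewrite -[z in free_lift g z]freeg_sumE linear_sum.
  rewrite (eq_bigr (fun j => coeff j z *: g j)); last first.
    by move=> j _; rewrite freegZ linearZZ; congr (_ *: _); exact: free_liftE.
  rewrite (bigD1_seq i) ?uniq_dom ?mem_dom//; last first.
    by apply: contra zi => /eqP ->; exact: ideal0.
  rewrite scalerDr scalerA vz scale1r => /eqP; rewrite addr_eq0 => /eqP ->.
  rewrite rpredN rpredZ// rpred_sum// => j ji; rewrite rpredZ//.
  by case: (unliftP i j) ji => [k ->|->]; rewrite ?eqxx.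
move=> x; have [y <-] := gs x; apply/(imP (free_lift g')).
elim/freeg_lin_ind: y => [|c u w uS wS|j]; first by rewrite linear0 rpred0.
  by rewrite linearP rpredD ?rpredZ.
by rewrite free_liftE; case: (unliftP i j) => [k ->|->].
Qed.

Lemma ex_minimal_gens M n : fgen M n -> exists p (g : 'I_p -> M),
  (forall x, exists z, free_lift g z = x) /\
  forall z, free_lift g z = 0 -> forall i, coeff i z \in m.
Proof.
move=> Mn; have ex : exists n, `[< fgen M n >] by exists n; exact/asboolP.
case: (ex_minnP ex) => p /asboolP Mp pmin; exists p.
by apply: minimal_gens => // q Mq; apply: pmin; exact/asboolP.
Qed.

(** With [residue_bilinr], the bilinear map from [M] and the residue field to [M / S] for [S]
    containing [mM], computed on representatives. *)
Lemma residue_bilinl M (S : submodule M) (c : residue) :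
  linear (fun x : M => quot_pi S ((repr c : R) *: x)).
Proof. by move=> d x y; rewrite scalerDr scalerA mulrC -scalerA linearP. Qed.

Lemma residue_bilinr M (S : submodule M) (x : M) :
  (forall (u : R) (y : M), u \in m -> u *: y \in S) ->
  linear (fun c : residue => quot_pi S ((repr c : R) *: x)).
Proof.
move=> mS d c c'; rewrite -linearP; apply/quot_piP.
rewrite scalerA -scalerDl -scalerBl; apply: mS.
apply/(@quot_piP R R^o m); apply: etrans (quot_reprK _) _; apply/esym.
apply: etrans (linearP (quot_pi m) d (repr c) (repr c')) _.
by congr (_ *: _ + _); exact: quot_reprK.
Qed.

(** Vanishing of the tensor product with the residue field gives [M = mM]. A minimal generator would
    then be a combination of generators with coefficients in [m], a relation with a coefficient
    [1 - z_i] that cannot lie in [m]; so there are no generators. *)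
Lemma nakayama M n : fgen M n -> tor_van 0 residue M -> zero_module M.
Proof.
move=> /ex_minimal_gens[p [g [gs gm]]] M0.
pose mM := Defs.span [set y : M | exists (u : R) (x : M), u \in m /\ y = u *: x].
have mS (u : R) (y : M) : u \in m -> u *: y \in mM.
  by move=> um; apply: mem_span; exists u, y.
have MmM x : x \in mM.
  have := congr1 (tlift (residue_bilinl mM) (fun x => residue_bilinr x mS))
    (M0 (tensor_pure x (quot_pi m 1))).
  rewrite tliftE linear0 => /quot_pi0 h.
  set r := repr _ in h.
  have r1 : 1 - r \in m by apply/(@quot_piP R R^o m)/esym; exact: quot_reprK.
  by rewrite -[x]scale1r -[1](subrK r) scalerDl rpredD// mS.
pose T0 : {pred M} := fun x => `[< exists2 z, forall i, coeff i z \in m & free_lift g z = x >].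
have Tc : submod_closed T0.
  split=> [|c u v /asboolP[y ym <-] /asboolP[z zm <-]]; apply/asboolP.
    by exists 0; rewrite ?linear0// => i; rewrite coeff0; exact: ideal0.
  exists (c *: y + z); last by rewrite linearP.
  by move=> i; rewrite coeffD coeffZ; apply: idealD => //; exact: idealMl.
have Tall x : x \in Submodule Tc.
  move: x (MmM x); apply: span_min => _ [u [x [um ->]]].
  have [z <-] := gs x; apply/asboolP; exists (u *: z); last by rewrite linearZZ.
  by move=> i; rewrite coeffZ mulrC; exact: idealMl.
have noi (i : 'I_p) : False.
  have /asboolP[z zm zE] := Tall (g i).
  have /gm/(_ i) : free_lift g (<< i >> - z) = 0.
    by rewrite linearB [X in _ - X]zE [X in X - _]free_liftE subrr.
  rewrite coeffB coeffU eqxx mulr1 => h.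
  have := idealD h (zm i); rewrite subrK; apply/negP; by case: maxm.
move=> x; have [z <-] := gs x; apply: (freeg_lin_ext (g := null_lin _ M)) => i.
by case: (noi i).
Qed.

(** For minimal generators the kernel [K] lies in [mF], so [K (x) k -> F (x) k] is zero. Vanishing
    of Tor_1 makes it injective, hence [K (x) k = 0] and [K = 0]. *)
Lemma tor1_residue_flat M n : fgen M n -> tor_van 1 residue M -> flat M.
Proof.
move=> /ex_minimal_gens[p [g [gs gm]]] M1.
have kses := ses_ker gs.
have [q Kq] := fgen_submodule (ker (free_lift g)) noethR (freeg_fg R p).
have K0 : tor_van 0 residue (submod (ker (free_lift g))).
  move=> u; apply: (inj0 (tor1_mapl_inj kses M1)) => /=.
  apply: (eq_tensor (f := @tensor_mapl R _ _ (val_lin (ker (free_lift g))) residue)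
    (g := null_lin _ _)) => -[z zk] c.
  suff zc : tensor_pure z c = 0 :> tensor {freeg 'I_p / R} residue.
    apply: (etrans (y := (tensor_pure z c : tensor {freeg 'I_p / R} residue))).
      exact: tensor_maplE.
    exact: zc.
  have zm i : coeff i z \in m by apply: gm; apply/eqP.
  rewrite -[z]freeg_sumE -purelE linear_sum big1// => i _ /=.
  rewrite freegZ tensor_pureZ residue_killed//; exact: (linear0 (purer _ _)).
have Kz := nakayama Kq K0.
apply: tor1_flat => N; apply: (tor_van_right (j := 0) kses).
  exact/flat_tor/flat_freeg.
exact: zero_tor_van.
Qed.

Lemma tor_residue_resolution d M n : fgen M n -> tor_van d.+1 residue M ->
  has_flat_resolution_of_length M d.
Proof.
elim: d M n => [|d IH] M n Mn Md.
  exact/flat_resolution0/(tor1_residue_flat Mn).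
have [g gs] := Mn.
apply: (flat_resolutionS (f := free_lift g)) => //; first exact: flat_freeg.
have [q Kq] := fgen_submodule (ker (free_lift g)) noethR (freeg_fg R n).
apply: (IH _ _ Kq); apply: (tor_van_left (ses_ker gs)) => //.
exact/flat_tor/flat_freeg.
Qed.

End LocalFiniteGeneration.

(** * Complexes with one cohomology module *)

Section OneCohomology.
Variables (R : comNzRingType) (C : cochain_complex R) (r n : nat) (H : lmodType R).
Variable p : {linear submod (cocycles C n) -> H}.
Hypotheses (C_bound : forall i, (r < i)%N -> zero_module (C i))
  (p_surj : forall h, exists z, p z = h)
  (p_eq0 : forall z, p z = 0 <-> is_coboundary (submod_val z))
  (C_exact : forall i (z : C i), i <> n -> coch_diff C i z = 0 -> is_coboundary z).
Implicit Types N : lmodType R.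

Definition boundaries i : submodule (C i) :=
  match i return submodule (C i) with
  | 0%N => ker (idl (C 0%N))
  | j.+1 => im (coch_diff C j)
  end.

Lemma boundariesP i (z : C i) : z \in boundaries i <-> is_coboundary z.
Proof.
case: i z => [|j] z /=; last exact: imP.
by split=> [/eqP//|->]; exact: eqxx.
Qed.

Lemma zero_boundaries0 : zero_module (submod (boundaries 0)).
Proof. by case=> z zB; apply: val_inj; apply/eqP. Qed.

Lemma diff_cocycles i z : coch_diff C i z \in cocycles C i.+1.
Proof. by apply/eqP; exact: coch_diffK. Qed.

Lemma diff_boundaries i z : coch_diff C i z \in boundaries i.+1.
Proof. by apply/boundariesP; exists z. Qed.

Lemma boundaries_cocycles (z : submod (boundaries n)) :
  val_lin (boundaries n) z \in cocycles C n.
Proof.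
apply/eqP => /=; have /boundariesP := submod_valP z.
case: (n) (submod_val z) => [|j] y /=; first by move=> ->; exact: linear0.
by move=> [x <-]; exact: coch_diffK.
Qed.

Lemma ses_cocycles i : i.+1 <> n ->
  ses (val_lin (cocycles C i)) (corestrict_lin (@diff_cocycles i)).
Proof.
move=> iN; split; first exact: val_inj.
  move=> y; split=> [/(congr1 val) /= y0|[[x xc] <-]].
    have yc : y \in cocycles C i by exact/eqP.
    by exists (SubMod yc).
  by apply: val_inj; apply/eqP.
move=> [z zc]; have [x xz] := C_exact iN (eqP zc).
by exists x; exact: val_inj.
Qed.

Lemma ses_boundaries i : i <> n ->
  ses (val_lin (boundaries i)) (corestrict_lin (@diff_boundaries i)).
Proof.
move=> iN; split; first exact: val_inj.
  move=> y; split=> [/(congr1 val) /= y0|[[x xb] <-]].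
    have yb : y \in boundaries i by exact/boundariesP/(C_exact iN).
    by exists (SubMod yb).
  apply: val_inj => /=; case: (i) x xb => [|j] x xb.
    by have /boundariesP/= -> := xb; exact: linear0.
  by have /boundariesP[w <-] := xb; exact: coch_diffK.
move=> [z zb]; have /boundariesP[x xz] := zb.
by exists x; exact: val_inj.
Qed.

Lemma ses_cohomology : ses (corestrict_lin boundaries_cocycles) p.
Proof.
split=> //; first by move=> x y /(congr1 val) /= xy; exact: val_inj.
move=> y; rewrite p_eq0; split=> [yb|[x <-]].
  have yB : submod_val y \in boundaries n by exact/boundariesP.
  by exists (SubMod yB); exact: val_inj.
exact/boundariesP/submod_valP.
Qed.

(** Descending induction from the bounded end, where cocycles vanish: degree [j] at [Z^i] follows
    from degree [j] at [C^i] and [j + 1] at [Z^(i+1)], so the bound [e] is kept. [k] measures the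
    distance to the end. *)
Lemma tor_van_cocycles N e l : (forall i, (l < i)%N -> i <> n) ->
  (forall i j, (l <= i)%N -> (e <= j)%N -> tor_van j N (C i)) ->
  forall j, (e <= j)%N -> tor_van j N (submod (cocycles C l)).
Proof.
move=> ln CN; suff: forall k i, (l <= i)%N -> (r < i + k)%N ->
    forall j, (e <= j)%N -> tor_van j N (submod (cocycles C i)).
  move=> /(_ r.+1 l (leqnn l)); apply; exact: leq_addl.
elim=> [|k IH] i li rik j ej.
  apply: zero_tor_van => x; apply: val_inj; apply: C_bound; by rewrite addn0 in rik.
apply: (tor_van_left (ses_cocycles (ln i.+1 _))); first exact: li.
  exact: CN.
apply: IH; [exact: leqW|by rewrite addSnnS|exact: leqW].
Qed.

(** Ascending from [B^0 = 0]: the sequence [B^i -> C^i -> B^(i+1)] raises the Tor degree by one at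
    each step. *)
Lemma tor_van_boundaries N d i : (i <= n)%N ->
  (forall i j, (d < j)%N -> tor_van j N (C i)) ->
  forall j, (d + i <= j)%N -> tor_van j N (submod (boundaries i)).
Proof.
move=> + CN; elim: i => [|i IH] ln j dj; first exact/zero_tor_van/zero_boundaries0.
case: j dj => [|j]; rewrite addnS // ltnS => dj.
have iN : i <> n by move=> iN; rewrite iN ltnn in ln.
apply: (tor_van_right (ses_boundaries iN)); last exact/IH/dj/ltnW.
by apply: CN; rewrite ltnS; apply: leq_trans dj; exact: leq_addr.
Qed.

Lemma tor_van_cohomology N d : (forall i j, (d < j)%N -> tor_van j N (C i)) ->
  tor_van (d + n).+1 N H.
Proof.
move=> CN; apply: (tor_van_right ses_cohomology); last first.
  exact: (tor_van_boundaries (leqnn n) CN).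
apply: (@tor_van_cocycles N d.+1 n); last by rewrite ltnS leq_addr.
  by move=> i ni iN; rewrite iN ltnn in ni.
by move=> i j _; exact: CN.
Qed.

(** The sequences are run backwards. Cocycles in degree [n] have vanishing Tor if [n > 0], so
    vanishing passes from [H] to [B^n] one degree lower, then from [B^(i+1)] to [B^i], again losing
    one, and reaches [B^1] in degree [j]. For [n = 0], [H] is [Z^0]. *)
Lemma cohomology_tor_van N j : (forall i j, tor_van j N (C i.+1)) ->
  tor_van (j + n) N H -> tor_van j N (C 0%N).
Proof.
move=> CN; have CN' l : (0 < l)%N -> (forall i, (l < i)%N -> i <> n) ->
    forall j, tor_van j N (submod (cocycles C l)).
  move=> l0 ln j'; apply: (@tor_van_cocycles N 0 l) => // i k li _.
  by case: i li => [|i _]; [rewrite leqNgt l0|exact: CN].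
have B0 k : tor_van k N (submod (boundaries 0)).
  exact/zero_tor_van/zero_boundaries0.
have [n0|n0] := posnP n.
  have Bn k : tor_van k N (submod (boundaries n)) by rewrite n0.
  rewrite n0 addn0 => HN.
  have Z0 := tor_van_mid ses_cohomology (Bn j) HN.
  have i1 : 1%N <> n by rewrite n0.
  apply: (tor_van_mid (ses_cocycles i1)); first by rewrite n0 in Z0.
  by apply: CN' => // i i1'; rewrite n0; case: i i1'.
rewrite -(prednK n0) addnS => HN.
have Zn : forall k, tor_van k N (submod (cocycles C n)).
  by apply: CN' => // i ni iN; rewrite iN ltnn in ni.
have := tor_van_left ses_cohomology (Zn _) HN.
suff down i : (i < n)%N -> tor_van (j + i) N (submod (boundaries i.+1)) ->
    tor_van j N (C 0%N).
  by move=> Bn; apply: (down n.-1); rewrite prednK.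
elim: i => [|i IH] ln Bi.
  have ne0 : 0%N <> n by move=> e; rewrite -e in n0.
  by apply: (tor_van_mid (ses_boundaries ne0)); rewrite ?addn0 in Bi *.
apply: IH; first exact: ltnW.
have iN : i.+1 <> n by move=> e; rewrite e ltnn in ln.
by apply: (tor_van_left (ses_boundaries iN)); rewrite -?addnS.
Qed.

End OneCohomology.

(** * Flat dimension and the theorem *)

Section FlatDimension.
Variable R : comNzRingType.
Implicit Types M : lmodType R.

Variant flat_dim_spec M : \bar int -> Prop :=
| FlatDimZero of zero_module M : flat_dim_spec M -oo%E
| FlatDimFin d of ~ zero_module M & has_flat_resolution_of_length M d
    & (forall e, has_flat_resolution_of_length M e -> (d <= e)%N) :
    flat_dim_spec M (d%:Z)%:E
| FlatDimInf of ~ zero_module M & (forall d, ~ has_flat_resolution_of_length M d) :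
    flat_dim_spec M +oo%E.

Lemma flat_dimP M : flat_dim_spec M (flat_dim M).
Proof.
rewrite /flat_dim; case: asboolP => M0; first exact: FlatDimZero.
case: pselect => [e|ne]; last first.
  by apply: FlatDimInf => // d Md; apply: ne; exists d; exact/asboolP.
case: ex_minnP => d /asboolP Md dmin; apply: FlatDimFin => // e' Me.
exact/dmin/asboolP.
Qed.

End FlatDimension.

Unset Implicit Arguments.

(** Properness of [a] in (ii) excludes [a = R], where all local cohomology vanishes while [M] need
    not. *)
Theorem theorem3p2 (R : comNzRingType) (noethR : noetherian R)
    (localR : local_ring R) (a : ideal R) (M : lmodType R)
    (I : injective_resolution M) (n : nat)
    (vanish : forall i : nat, i <> n -> zero_module (local_cohomology a I i)) :
  (flat_dim (local_cohomology a I n) <= flat_dim M + (n%:Z)%:E)%E /\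
  (1 \notin a -> finitely_generated M ->
   flat_dim (local_cohomology a I n) = (flat_dim M + (n%:Z)%:E)%E).
Proof.
have [s aE] : exists s : seq R, a =i Defs.span [set` (s : seq R^o)] := noethR a.
pose C := cech s M; set H := local_cohomology a I n.
have bC i : (size s < i)%N -> zero_module (C i) by exact: cech_bound.
have [p ps p0] := cech_local_cohomology noethR aE n I.
have exC i (z : C i) : i <> n -> coch_diff C i z = 0 -> is_coboundary z.
  move=> iN z0; have [q _ q0] := cech_local_cohomology noethR aE i I.
  have zc : z \in cocycles C i by exact/eqP.
  by have /q0 : q (SubMod zc) = 0 by exact: vanish.
have resH d : has_flat_resolution_of_length M d ->
    has_flat_resolution_of_length H (d + n).
  move=> Md; apply: tor_flat_resolution => N.
  apply: (tor_van_cohomology bC ps p0 exC) => i [//|j] dj.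
  exact/cech_tor_van/(flat_resolution_tor N Md).
have zeroH : zero_module M -> zero_module H.
  move=> M0 h; have [z <-] := ps h; rewrite [z](_ : _ = 0) ?linear0//.
  by apply: val_inj; exact: cech_zero.
have leH : (flat_dim H <= flat_dim M + (n%:Z)%:E)%E.
  case: (flat_dimP M) => [/zeroH H0|d _ /resH Hd _|_ _]; last exact: leey.
    by case: (flat_dimP H) => // ? /(_ H0).
  case: (flat_dimP H) => [_|e _ _ /(_ _ Hd) ed|_ /(_ _ Hd)//]; first exact: leNye.
  by rewrite -EFinD lee_fin -PoszD lez_nat.
split=> // a1 fgM.
have [m maxm mu] := localR.
have [q Mq] := fg_fgen fgM.
have am := local_proper_sub mu a1.
have torM j : tor_van (j + n) (residue m) H -> tor_van j (residue m) M.
  move=> Hj; rewrite -(cech0 s M); apply: (cohomology_tor_van bC ps p0 exC) Hj => i k.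
  apply: cech_tor_van_killed => x xs c; apply: residue_killed; apply: am.
  by rewrite aE; exact: mem_span.
(* The value [-oo] must occur on both sides together; this is the case [j = 0] followed by
   Nakayama's lemma. *)
have M_H0 : zero_module H -> zero_module M.
  move=> H0; apply: (nakayama maxm mu Mq); apply: torM; exact: zero_tor_van.
apply/eqP; rewrite eq_le leH /=.
case: (flat_dimP H) => [/M_H0 M0|e nH He _|_ _]; last exact: leey.
  by case: (flat_dimP M) => // ? /(_ M0).
have Hj j : (e < j)%N -> tor_van j (residue m) H by exact: flat_resolution_tor.
have nM : ~ zero_module M by move=> /zeroH.
(* Otherwise Tor_n(k, H) = 0, which is the case [j = 0] again and would make [M] zero. *)
have ne : (n <= e)%N.
  rewrite leqNgt; apply/negP => en; apply: nM; apply: (nakayama maxm mu Mq).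
  exact/torM/Hj.
(* Degree [e - n + 1] at [M] corresponds to degree [e + 1] at [H], the first one above the length of
   its resolution. *)
have Me : has_flat_resolution_of_length M (e - n).
  apply: (tor_residue_resolution noethR maxm mu Mq); apply: torM; apply: Hj.
  by rewrite addSn subnK.
case: (flat_dimP M) => [//|d _ _ /(_ _ Me) de|_ /(_ _ Me)//].
by rewrite -EFinD lee_fin -PoszD lez_nat addnC -leq_subRL.
Qed.
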